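(* Let $K:\mathbb{T}^{d-1}\times\mathbb{T}^\ell\to U$ be a (smooth) parameterization of a $\phi_T$-invariant torus $\mathcal{K}$ on which the dynamics is conjugate to an ergodic rotation, that is, $$\phi_T\big(K(\theta,\varphi),\varphi\big)=K(\theta+\omega,\varphi+\alpha)\qquad\text{for all }(\theta,\varphi)\in\mathbb{T}^{d-1}\times\mathbb{T}^\ell,$$ with $(\omega,\alpha)\in\mathbb{R}^{d-1}\times\mathbb{R}^\ell$ rationally independent. For each $\varphi\in\mathbb{T}^\ell$, let $K_\varphi:\mathbb{T}^{d-1}\to U$, $K_\varphi(\theta)=K(\theta,\varphi)$, be the parameterization of the torus $\mathcal{K}_\varphi\subset\mathcal{K}$. Then for each $\varphi\in\mathbb{T}^\ell$ the torus $\mathcal{K}_\varphi$ is isotropic, i.e. $$\mathrm{D}_\theta K_\varphi(\theta)^\top\,\Omega\big(K_\varphi(\theta)\big)\,\mathrm{D}_\theta K_\varphi(\theta)=0\qquad\text{for all }\theta\in\mathbb{T}^{d-1},$$ and thus $\mathcal{K}$ is fiberwise isotropic.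
   Context: All maps are assumed sufficiently smooth. $\mathbb{T}^m=\mathbb{R}^m/\mathbb{Z}^m$; $U\subset\mathbb{R}^{2n}$ is open. $\mathrm{D}$, $\mathrm{D}_z$, $\mathrm{D}_\theta$ denote (partial) Jacobian matrices, so the derivative of a scalar function is a row vector. $a:U\to\mathbb{R}^{2n}$ is a smooth map such that $\Omega(z):=\mathrm{D}a(z)^\top-\mathrm{D}a(z)$ is invertible for every $z\in U$ ($\Omega$ represents an exact symplectic form on $U$). $\hat\alpha\in\mathbb{R}^\ell$ is fixed, $H:U\times\mathbb{T}^\ell\to\mathbb{R}$ is a smooth Hamiltonian and $X_H(z,\varphi):=\Omega(z)^{-1}\mathrm{D}_zH(z,\varphi)^\top$. The evolution operator $\phi_t(z,\varphi)\in U$ is the solution of $\frac{d}{dt}\phi_t(z,\varphi)=X_H\big(\phi_t(z,\varphi),\varphi+\hat\alpha t\big)$, $\phi_0(z,\varphi)=z$, on its maximal interval of existence. $T>0$ is fixed, $\alpha:=T\hat\alpha$, and $\phi_T$ is assumed to be defined at all points $(K(\theta,\varphi),\varphi)$. ''$(\omega,\alpha)$ rationally independent'' means that the rotation $(\theta,\varphi)\mapsto(\theta+\omega,\varphi+\alpha)$ on $\mathbb{T}^{d-1}\times\mathbb{T}^\ell$ is ergodic: $k\cdot\omega+j\cdot\alpha-m\neq0$ for all $(k,j)\in\mathbb{Z}^{d-1}\times\mathbb{Z}^\ell\setminus\{0\}$ and all $m\in\mathbb{Z}$. ''Fiberwise isotropic'' means that $\mathcal{K}_\varphi$ is isotropic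 for every $\varphi\in\mathbb{T}^\ell$. *)

(* Defs.v *)
From HB Require Import structures.
From mathcomp Require Export all_boot all_order all_algebra.
From mathcomp Require Export all_classical all_reals all_analysis.

Set Implicit Arguments.
Unset Strict Implicit.
Unset Printing Implicit Defensive.

Import Order.TTheory GRing.Theory Num.Theory.
Import numFieldNormedType.Exports.

Local Open Scope classical_set_scope.
Local Open Scope ring_scope.

(* Points of R^m are column vectors.  A map on the torus T^m = R^m / Z^m is
   represented by its lift, i.e. a map on R^m invariant under translation by
   integer vectors; a point of T^m by an arbitrary representative. *)

Definition intvec (R : realType) (m : nat) (k : 'cV[int]_m) : 'cV[R]_m :=
  map_mx intr k.

(* Meaningful for A open and V finite-dimensional, where differentiability
   together with C^k directional derivatives amounts to the usual C^k.+1. *)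
Fixpoint class_C (R : realType) (V W : normedModType R) (k : nat)
    (A : set V) (f : V -> W) : Prop :=
  if k is k'.+1 then
    (forall x, A x -> differentiable f x) /\
    (forall v, class_C k' A (fun x => 'D_v f x))
  else forall x, A x -> {for x, continuous f}.

(* Row index = component, column index = variable.  (The library's
   [jacobian] acts on row vectors and is the transpose of this.) *)
Definition Jac (R : realType) (m p : nat) (f : 'cV[R]_m -> 'cV[R]_p)
    (x : 'cV[R]_m) : 'M[R]_(p, m) :=
  \matrix_(i < p, j < m) ('D_(delta_mx j ord0) f x) i ord0.

Definition Dscal (R : realType) (m : nat) (f : 'cV[R]_m -> R)
    (x : 'cV[R]_m) : 'rV[R]_m :=
  \row_(j < m) 'D_(delta_mx j ord0) (f : 'cV[R]_m -> R^o) x.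

Definition Omega (R : realType) (m : nat) (a : 'cV[R]_m -> 'cV[R]_m)
    (z : 'cV[R]_m) : 'M[R]_m :=
  (Jac a z)^T - Jac a z.

Definition hamiltonian_field (R : realType) (m l : nat)
    (a : 'cV[R]_m -> 'cV[R]_m) (H : 'cV[R]_m * 'cV[R]_l -> R)
    (z : 'cV[R]_m) (phi : 'cV[R]_l) : 'cV[R]_m :=
  invmx (Omega a z) *m (Dscal (fun y => H (y, phi)) z)^T.

Definition is_solution (R : realType) (m l : nat) (U : set 'cV[R]_m)
    (X : 'cV[R]_m -> 'cV[R]_l -> 'cV[R]_m) (alphahat : 'cV[R]_l)
    (z : 'cV[R]_m) (phi : 'cV[R]_l) (J : set R) (x : R -> 'cV[R]_m) : Prop :=
  [/\ open J, is_interval J, J 0, x 0 = z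
    & forall t, J t ->
        U (x t) /\ is_derive t 1 x (X (x t) (phi + t *: alphahat))].

Definition is_maximal_solution (R : realType) (m l : nat) (U : set 'cV[R]_m)
    (X : 'cV[R]_m -> 'cV[R]_l -> 'cV[R]_m) (alphahat : 'cV[R]_l)
    (z : 'cV[R]_m) (phi : 'cV[R]_l) (J : set R) (x : R -> 'cV[R]_m) : Prop :=
  is_solution U X alphahat z phi J x /\
  forall (J' : set R) (x' : R -> 'cV[R]_m),
    is_solution U X alphahat z phi J' x' ->
    J `<=` J' -> (forall t, J t -> x' t = x t) -> J' = J.

(* [E t z phi] is the evolution operator at time t; it is meaningful for t in
   the maximal interval of existence [I z phi], and arbitrary elsewhere. *)
Definition is_evolution_operator (R : realType) (m l : nat)
    (U : set 'cV[R]_m) (X : 'cV[R]_m -> 'cV[R]_l -> 'cV[R]_m)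
    (alphahat : 'cV[R]_l) (I : 'cV[R]_m -> 'cV[R]_l -> set R)
    (E : R -> 'cV[R]_m -> 'cV[R]_l -> 'cV[R]_m) : Prop :=
  forall z phi, U z ->
    is_maximal_solution U X alphahat z phi (I z phi) (fun t => E t z phi).

Definition rationally_independent (R : realType) (m l : nat)
    (omega : 'cV[R]_m) (alpha : 'cV[R]_l) : Prop :=
  forall (k : 'cV[int]_m) (j : 'cV[int]_l) (q : int),
    (k, j) <> (0, 0) ->
    \sum_(i < m) (k i ord0)%:~R * omega i ord0
      + \sum_(i < l) (j i ord0)%:~R * alpha i ord0 - q%:~R <> 0.

Definition isotropic (R : realType) (m p : nat) (a : 'cV[R]_m -> 'cV[R]_m)
    (L : 'cV[R]_p -> 'cV[R]_m) : Prop :=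
  forall theta, (Jac L theta)^T *m Omega a (L theta) *m Jac L theta = 0.

Definition fiberwise_isotropic (R : realType) (m p l : nat)
    (a : 'cV[R]_m -> 'cV[R]_m) (K : 'cV[R]_p * 'cV[R]_l -> 'cV[R]_m) : Prop :=
  forall phi, isotropic a (fun theta => K (theta, phi)).

(* Main.v *)
Require Import Defs.
From mathcomp Require Import all_boot all_order all_algebra.
From mathcomp Require Import all_classical all_reals all_analysis.
From mathcomp Require Import perm ring lra.
From mathcomp.real_closed Require Import complex.
Import Order.TTheory GRing.Theory Num.Theory.
Import numFieldNormedType.Exports.
Local Open Scope classical_set_scope.
Local Open Scope ring_scope.

(** The torus is isotropic because the pullback of the symplectic form to its
fibres is both constant and exact.

Let [b_j = a(K) . D_j K], where [D_j] is the derivative in the [j]-th fibre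
coordinate, be the components of the primitive one-form pulled back to the
fibres, and let [curl i j = D_i b_j - D_j b_i].  Expanding the derivatives and
cancelling the mixed second derivatives of [K] shows that [curl i j] is the
[(i, j)] entry of [DK^T Omega(K) DK] ([curl_pullback_form]).  Three facts give
[curl = 0].

Invariance ([curl_invariant]).  The time-[T] map is exact symplectic on each
fibre.  The vector field is only C^1, and the flow is never differentiated in
its initial condition; the generating function is obtained from the action
[s = int_0^T (a(x) . x' - H) dt] of the orbit [x] that starts on the torus.
Orbits are critical points of the action, so the actions of two nearby orbits
[x] and [y] in one fibre differ by the boundary term [a(x) . (y - x)] between
the times [0] and [T], up to an error quadratic in [y - x]
([action_estimate]).  Gronwall bounds this error by the square of the initial
distance ([vector_gronwall]), so Lipschitz dependence on the initial condition
is enough.  The end points lie on the torus, one rotation further, hence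
[D_j s = b_j o rotation - b_j] ([generating_function]); as the second
derivatives of [s] commute, the curl is invariant under the rotation.

Ergodicity ([curl_constant]).  A rationally independent rotation has dense
orbits ([kronecker]), so a continuous invariant function is constant.

Exactness ([constant_curl_zero]).  A constant which is the curl of a periodic
field vanishes, since the averages of derivatives of periodic functions do. *)

(** * Kronecker's density theorem *)

Section circle.
Variable R : realType.
Local Open Scope complex_scope.

(** The character [e^(2 i pi t)] of [R / Z]. *)
Definition cis2pi (t : R) : R[i] := cos (pi *+ 2 * t) +i* sin (pi *+ 2 * t).

Lemma cis2piD (s t : R) : cis2pi (s + t) = cis2pi s * cis2pi t.
Proof.
rewrite /cis2pi mulrDr cosD sinD; apply/eqP; rewrite eq_complex /=.
by rewrite !eqxx /= addrC [X in _ == X]addrC; apply/eqP; ring.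
Qed.

Lemma cis2pi0 : cis2pi 0 = 1.
Proof. by rewrite /cis2pi mulr0 cos0 sin0. Qed.

Lemma cis2piMn (t : R) n : cis2pi (n%:R * t) = cis2pi t ^+ n.
Proof.
elim: n => [|n ih]; first by rewrite mul0r cis2pi0 expr0.
by rewrite -natr1 mulrDl mul1r cis2piD ih exprSr.
Qed.

Lemma cis2pi_sum (I : finType) (F : I -> R) :
  cis2pi (\sum_i F i) = \prod_i cis2pi (F i).
Proof. by apply: (big_morph cis2pi cis2piD cis2pi0). Qed.

(** The left-hand side is the squared modulus of [(1 + e^(2 i pi x)) / 2], the
conjugate being obtained by changing the sign of [x]. *)
Lemma half_cis2pi_sqr (x : R) :
  (1 + cis2pi x) / 2 * ((1 + cis2pi (- x)) / 2) = (cos (pi * x) ^+ 2)%:C.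
Proof.
have E : (1 + cis2pi x) * (1 + cis2pi (- x)) = ((cos (pi * x) ^+ 2) *+ 4)%:C.
  rewrite mulrDl mul1r mulrDr mulr1 -cis2piD subrr cis2pi0.
  rewrite /cis2pi mulrN cosN sinN; apply/eqP; rewrite eq_complex /=.
  have -> : pi *+ 2 * x = pi * x + pi * x :> R by rewrite mulr2n mulrDl.
  rewrite cosD; have := cos2Dsin2 (pi * x) => h.
  apply/andP; split; apply/eqP; last by ring.
  by rewrite -!expr2 -mulr_natr; lra.
have -> : (1 + cis2pi x) / 2 * ((1 + cis2pi (- x)) / 2)
  = ((1 + cis2pi x) * (1 + cis2pi (- x))) * (4^-1) by field.
rewrite E rmorphMn /= -mulr_natr mulfK//; by rewrite pnatr_eq0.
Qed.

Lemma half_cis2pi_expn p (x : R) :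
  ((1 + cis2pi x) / 2) ^+ p =
  \sum_(k < p.+1) ('C(p, k)%:R / 2 ^+ p : R)%:C * cis2pi (k%:R * x).
Proof.
rewrite expr_div_n exprDn mulr_suml; apply: eq_bigr => k _.
rewrite expr1n mul1r cis2piMn rmorphM /= fmorphV rmorphXn /= !rmorph_nat.
by rewrite -mulr_natl mulrAC.
Qed.

Variables (I : finType) (p : nat).

(** The Fourier coefficients of [\prod_i ((1 + e^(2 i pi x_i)) / 2) ^ p]. *)
Definition binom_weight (m : {ffun I -> 'I_p.+1}) : R := \prod_i ('C(p, m i)%:R / 2 ^+ p).

Lemma prod_half_cis2pi_expn (x : I -> R) :
  \prod_i ((1 + cis2pi (x i)) / 2) ^+ p =
  \sum_(m : {ffun I -> 'I_p.+1}) (binom_weight m)%:C * cis2pi (\sum_i (m i)%:R * x i).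
Proof.
under eq_bigr do rewrite half_cis2pi_expn.
rewrite bigA_distr_bigA /=; apply: eq_bigr => m _.
by rewrite big_split /= cis2pi_sum rmorph_prod.
Qed.

Lemma binom_weight_ge0 m : 0 <= binom_weight m.
Proof. by apply: prodr_ge0 => i _; rewrite divr_ge0 ?exprn_ge0. Qed.

Lemma sum_binom_weight : \sum_m binom_weight m = 1.
Proof.
have := prod_half_cis2pi_expn (fun=> 0); rewrite cis2pi0.
have -> : (1 + 1) / 2 = 1 :> R[i] by field.
rewrite big1; last by move=> *; rewrite expr1n.
move=> h; apply: complexI; rewrite rmorph_sum rmorph1 h.
apply: eq_bigr => m _; rewrite big1 ?cis2pi0 ?mulr1// => i _.
by rewrite mulr0.
Qed.

(** Cauchy-Schwarz: the weights sum to 1 and there are [p.+1 ^ #|I|] of them.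
This lower bound is polynomial in [p], whereas the kernel below decays
exponentially in [p] away from the integer points. *)
Lemma sum_binom_weight_sqr : (p.+1 ^ #|I|)%:R^-1 <= \sum_m binom_weight m ^+ 2.
Proof.
set N := (p.+1 ^ #|I|)%N.
have N0 : (0 : R) < N%:R by rewrite ltr0n expn_gt0.
have cN : \sum_(m : {ffun I -> 'I_p.+1}) (1 : R) = N%:R.
  by rewrite sumr_const card_ffun card_ord.
have : 0 <= \sum_m (binom_weight m - N%:R^-1) ^+ 2 by apply: sumr_ge0 => *; exact: sqr_ge0.
under eq_bigr do rewrite sqrrB.
rewrite big_split sumrB /= sumrMnl -mulr_suml sum_binom_weight.
have -> : \sum_(m : {ffun I -> 'I_p.+1}) (N%:R^-1 : R) ^+ 2 = N%:R^-1.
  under eq_bigr do rewrite -[_ ^+ 2]mulr1.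
  by rewrite -mulr_sumr cN; field; rewrite gt_eqF.
by rewrite mul1r; lra.
Qed.

(** The kernel on the right is concentrated near the integer points; it is the
squared modulus of the product expanded in [prod_half_cis2pi_expn].  Only the
diagonal terms [m = m'] survive averaging along an orbit of the rotation. *)
Lemma cos_kernel_expansion (x : I -> R) :
  \sum_m \sum_m' binom_weight m * binom_weight m' * cos (pi *+ 2 * (\sum_i ((m i)%:R - (m' i)%:R) * x i))
  = \prod_i (cos (pi * x i) ^+ 2) ^+ p.
Proof.
have : \sum_m \sum_m' (binom_weight m * binom_weight m')%:C *
   cis2pi (\sum_i ((m i)%:R - (m' i)%:R) * x i)
  = (\prod_i (cos (pi * x i) ^+ 2) ^+ p)%:C.
  rewrite rmorph_prod /=; under [RHS]eq_bigr do rewrite rmorphXn /= -half_cis2pi_sqr exprMn.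
  rewrite big_split /= !prod_half_cis2pi_expn mulr_suml; apply: eq_bigr => m _.
  rewrite mulr_sumr; apply: eq_bigr => m' _.
  rewrite rmorphM /= mulrACA -cis2piD -big_split /=; congr (_ * cis2pi _).
  by apply: eq_bigr => i _; rewrite mulrBl mulrN.
move=> /(congr1 (@complex.Re R)); rewrite /= => <-.
rewrite raddf_sum; apply: eq_bigr => m _; rewrite raddf_sum; apply: eq_bigr => m' _.
by rewrite /= mul0r subr0.
Qed.

End circle.

Section kronecker.
Variable R : realType.

Lemma sin_sqr_shift (q : int) (x : R) :
  sin (pi * (x + q%:~R)) ^+ 2 = sin (pi * x) ^+ 2.
Proof.
have nat_case (k : nat) (y : R) : sin (pi * (y + k%:R)) ^+ 2 = sin (pi * y) ^+ 2.
  elim: k => [|k ih]; first by rewrite addr0.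
  by rewrite -natr1 addrA mulrDr mulr1 sinDpi sqrrN.
case: q => k; first exact: nat_case.
by rewrite NegzE -[in RHS](subrK (k.+1%:~R) x) mulrNz nat_case.
Qed.

(** [1 - cos (2 pi t) = 2 sin^2 (pi t)], and the zeros of [sin (pi .)] are the
integers. *)
Lemma cos2pi_eq1 (t : R) : cos (pi *+ 2 * t) = 1 -> exists q : int, t = q%:~R.
Proof.
have -> : pi *+ 2 * t = pi * t + pi * t by rewrite mulr2n mulrDl.
rewrite cosD => h.
have s0 : sin (pi * t) ^+ 2 = 0.
  by have := cos2Dsin2 (pi * t); move: h; rewrite -!expr2; lra.
exists (Num.floor t); set r := t - (Num.floor t)%:~R.
have r0 : 0 <= r by rewrite subr_ge0 floor_le.
have r1 : r < 1 by rewrite ltrBlDl -intrD1 floorD1_gt.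
have : sin (pi * r) ^+ 2 = 0 by rewrite /r -mulrNz sin_sqr_shift.
move/eqP; rewrite sqrf_eq0 => /eqP sr.
apply/eqP; rewrite -subr_eq0 -/r; apply/negPn/negP => rn.
have : 0 < sin (pi * r).
  have p0 := @pi_gt0 R; have {}r0 : 0 < r by rewrite lt_neqAle eq_sym rn.
  by apply: sin_gt0_pi; rewrite mulr_gt0//= gtr_pMr.
by rewrite sr ltxx.
Qed.

(** [2 sin (pi b) cos u] is [sin (u + pi b) - sin (u - pi b)], so that the sum
telescopes. *)
Lemma sum_cos_bounded (a b : R) : cos (pi *+ 2 * b) <> 1 ->
  exists C : R, forall M : nat,
    `|\sum_(n < M) cos (pi *+ 2 * (n%:R * b - a))| <= C.
Proof.
move=> hb; set B := pi * b.
have sB : sin B != 0.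
  apply/eqP => s0; apply: hb.
  have -> : pi *+ 2 * b = B + B by rewrite mulr2n mulrDl.
  by rewrite cosD s0; have := cos2Dsin2 B; rewrite s0 -!expr2; lra.
pose g n : R := sin (pi *+ 2 * (n%:R * b - a) - B).
have E n : cos (pi *+ 2 * (n%:R * b - a)) = (g n.+1 - g n) / (sin B *+ 2).
  have -> : g n.+1 = sin (pi *+ 2 * (n%:R * b - a) + B).
    by congr sin; rewrite /B -natr1; ring.
  by rewrite sinD /g sinB -mulr_natr; field.
exists (2 / `|sin B *+ 2|) => M.
under eq_bigr do rewrite E.
rewrite -mulr_suml -(big_mkord xpredT (fun n => g n.+1 - g n)) telescope_sumr//.
rewrite normrM normfV.
rewrite ler_wpM2r ?invr_ge0//.
rewrite (le_trans (ler_normB _ _))// -[2]/(1 + 1) lerD// ler_norml.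
  by rewrite sin_geN1 sin_le1.
by rewrite sin_geN1 sin_le1.
Qed.

Lemma bernoulli_ineq (h : R) k : 0 <= h -> 1 + k%:R * h <= (1 + h) ^+ k.
Proof.
move=> h0; elim: k => [|k ih]; first by rewrite mul0r addr0 expr0.
rewrite exprSr; apply: (@le_trans _ _ ((1 + k%:R * h) * (1 + h))).
  by rewrite -natr1 -subr_ge0 [leRHS](_ : _ = k%:R * h ^+ 2); [rewrite mulr_ge0 ?exprn_ge0|ring].
by rewrite ler_wpM2r// addr_ge0.
Qed.

Lemma exp_beats_poly (q : R) (N : nat) : 0 <= q < 1 ->
  exists p : nat, q ^+ p * (p.+1 ^ N)%:R < 1.
Proof.
move=> /andP[]; rewrite le_eqVlt => /predU1P[<- _|q0 q1].
  by exists 1; rewrite expr1 mul0r.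
set h := q^-1 - 1.
have h0 : 0 < h by rewrite subr_gt0 invf_gt1.
have [k hk] : exists k : nat, 2 * N.+1%:R / h ^+ 2 < k%:R.
  by exists (Num.truncn (2 * N.+1%:R / h ^+ 2)).+1; rewrite truncnS_gt.
have k0 : 0 < k%:R :> R by apply: le_lt_trans hk; rewrite divr_ge0 ?exprn_ge0 ?ltW.
(* With this exponent the left-hand side is at most the [N.+1]-st power of
   [q ^ (2 k)] times a number linear in [k]; by Bernoulli's inequality for
   [q^-1 = 1 + h], the factor [q ^ (2 k)] decays like [k ^ -2]. *)
exists (k * 2 * N.+1)%N.
apply: (@le_lt_trans _ _ ((q ^+ (k * 2) * (k * 2 * N.+1).+1%:R) ^+ N.+1)).
  rewrite exprMn -exprM ler_wpM2l ?exprn_ge0 ?(ltW q0)// -natrX ler_nat.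
  by rewrite leq_pexp2l.
apply: exprn_ilt1 => //; first by rewrite mulr_ge0 ?exprn_ge0 ?(ltW q0).
have qk : q ^+ k * (1 + k%:R * h) <= 1.
  apply: (@le_trans _ _ (q ^+ k * (1 + h) ^+ k)).
    by rewrite ler_wpM2l ?exprn_ge0 ?(ltW q0)// bernoulli_ineq// ltW.
  by rewrite -exprMn addrC subrK divff ?gt_eqF// expr1n.
have L : (k * 2 * N.+1).+1%:R < (1 + k%:R * h) ^+ 2.
  rewrite ltr_pdivrMr ?exprn_gt0// in hk.
  rewrite -natr1 !natrM.
  have : k%:R * (2 * N.+1%:R) < k%:R * (k%:R * h ^+ 2) by rewrite ltr_pM2l.
  have : 0 < k%:R * h by rewrite mulr_gt0.
  by nra.
apply: (@lt_le_trans _ _ ((q ^+ k * (1 + k%:R * h)) ^+ 2)).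
  by rewrite exprMn -exprM ltr_pM2l// exprn_gt0.
by rewrite exprn_ile1// mulr_ge0 ?exprn_ge0 ?(ltW q0)// addr_ge0// mulr_ge0// ltW.
Qed.

Lemma cos_far_from_int (eps x : R) : 0 < eps < 1 / 2 ->
  (forall q : int, eps <= `|x - q%:~R|) ->
  cos (pi * x) ^+ 2 <= cos (pi * eps) ^+ 2 < 1.
Proof.
move=> /andP[e0 e1] far; have p0 := @pi_gt0 R.
have se : 0 < sin (pi * eps) by apply: sin_gt0_pi; rewrite mulr_gt0//= gtr_pMr//; lra.
apply/andP; split; last first.
  by rewrite -(cos2Dsin2 (pi * eps)) ltrDl exprn_gt0.
set r := x - (Num.floor x)%:~R.
have -> : cos (pi * x) ^+ 2 = cos (pi * r) ^+ 2.
  have := cos2Dsin2 (pi * x); have := cos2Dsin2 (pi * r).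
  by rewrite /r -mulrNz sin_sqr_shift; lra.
have r0 : eps <= r.
  by have := far (Num.floor x); rewrite -/r ger0_norm// subr_ge0 floor_le.
have r1 : r <= 1 - eps.
  have := far (Num.floor x + 1); rewrite distrC ger0_norm; last first.
    by rewrite subr_ge0 ltW// floorD1_gt.
  by rewrite /r intrD; lra.
have anti (u v : R) : 0 <= u -> u <= v -> v <= 1 -> cos (pi * v) <= cos (pi * u).
  move=> u0 uv v1; rewrite leNgt ltr_cos ?in_itv/=.
  - by rewrite -leNgt ler_pM2l.
  - by rewrite (mulr_ge0 (ltW p0) (le_trans u0 uv)) (ger_pMr _ p0).
  - by rewrite (mulr_ge0 (ltW p0) u0) (ger_pMr _ p0) (le_trans uv).
have h1 : cos (pi * r) <= cos (pi * eps) by apply: anti; lra.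
have h2 : - cos (pi * r) <= cos (pi * eps).
  have := anti eps (1 - r); rewrite mulrBr mulr1 cosB cospi sinpi mul0r addr0 mulN1r.
  by apply; lra.
by rewrite -subr_ge0 subr_sqr mulr_ge0; lra.
Qed.

(** Bohr's argument.  If the orbit avoided the box of radius [eps] around [y]
modulo integers, the kernel [\prod_i cos (pi x_i) ^ (2 p)] would be at most
[Q ^ p] along it, with [Q < 1].  Its time average is however the sum of the
squared weights, since every other character in its expansion averages to zero
by independence.  This contradicts [sum_binom_weight_sqr] for large [p]. *)
Lemma kronecker (I : finType) (rho y : I -> R) :
  (forall (k : I -> int) (q : int),
     \sum_i (k i)%:~R * rho i = q%:~R -> forall i, k i = 0) ->
  forall eps : R, 0 < eps ->
  exists (n : nat) (q : I -> int),
    forall i, `|n%:R * rho i - y i - (q i)%:~R| < eps.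
Proof.
move=> indep eps eps0.
wlog eps_small : eps eps0 / eps < 1 / 2.
  move=> wl; have [||n [q h]] := wl (Num.min eps (1 / 3)).
  - by rewrite lt_min eps0 /=; lra.
  - by rewrite gt_min; apply/orP; right; lra.
  by exists n, q => i; apply: (lt_le_trans (h i)); rewrite ge_min lexx.
apply: contrapT => far.
pose x n i := n%:R * rho i - y i.
have {}far n : exists i, forall q : int, eps <= `|x n i - q%:~R|.
  apply: contrapT => h; apply: far; exists n.
  have : forall i, exists q : int, `|x n i - q%:~R| < eps.
    move=> i; apply: contrapT => hi; apply: h; exists i => q.
    by rewrite leNgt; apply/negP => hq; apply: hi; exists q.
  by move=> /choice[q hq]; exists q.
set Q := cos (pi * eps) ^+ 2.
have Q01 : 0 <= Q < 1.
  rewrite sqr_ge0 /=.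
  by have [i /cos_far_from_int] := far 0; rewrite eps0 eps_small => /(_ isT)/andP[].
have [p hp] := exp_beats_poly Q #|I| Q01.
set c := binom_weight R I p; set W := \sum_m c m ^+ 2.
have small n : \prod_i (cos (pi * x n i) ^+ 2) ^+ p <= Q ^+ p.
  have [i hi] := far n.
  have le1 (t : R) : cos t ^+ 2 <= 1 by rewrite -(cos2Dsin2 t) lerDl sqr_ge0.
  rewrite (bigD1 i)//= -[leRHS]mulr1 ler_pM//.
  - by rewrite exprn_ge0 ?sqr_ge0.
  - by apply: prodr_ge0 => *; rewrite exprn_ge0 ?sqr_ge0.
  - rewrite lerXn2r ?nnegrE ?sqr_ge0//.
    by have /andP[] := cos_far_from_int eps (x n i) (introT andP (conj eps0 eps_small)) hi.
  - by apply: prodr_ile1 => j _; rewrite exprn_ge0 ?sqr_ge0// exprn_ile1 ?sqr_ge0.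
have WQ : Q ^+ p < W.
  apply: lt_le_trans (sum_binom_weight_sqr R I p).
  by rewrite -[ltRHS]mul1r ltr_pdivlMr// ltr0n expn_gt0.
(* Sums over the orbit of the characters of [cos_kernel_expansion]: equal to
   [M] for [m = m'], and bounded in [M] otherwise. *)
pose S (m m' : {ffun I -> 'I_p.+1}) (M : nat) : R := \sum_(n < M)
  cos (pi *+ 2 * (\sum_i ((m i)%:R - (m' i)%:R) * x n i)).
have bS mm : exists C : R, mm.1 != mm.2 -> forall M, `|S mm.1 mm.2 M| <= C.
  case: mm => m m' /=.
  have [->|mm'] := eqVneq m m'; first by exists 0.
  pose k i := ((m i)%:Z - (m' i)%:Z)%R.
  have [|C hC] := sum_cos_bounded (\sum_i (k i)%:~R * y i) (\sum_i (k i)%:~R * rho i).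
    move=> /cos2pi_eq1[q /indep k0]; case/eqP: mm'; apply/ffunP => i.
    by apply/val_inj/eqP; have /eqP := k0 i; rewrite subr_eq0 eqz_nat.
  exists C => _ M; rewrite /S; have := hC M; congr (`| _ | <= _).
  apply: eq_bigr => n _; congr (cos (_ * _)).
  rewrite mulr_sumr -sumrB; apply: eq_bigr => i _.
  by rewrite /x /k intrB; ring.
have {bS}[C hC] := choice bS.
pose C0 := \sum_m \sum_m' c m * c m' * `|C (m, m')|.
have bound M : M%:R * (W - Q ^+ p) <= C0.
  rewrite mulrBr lerBlDr.
  have -> : M%:R * W = \sum_m \sum_m' (m == m')%:R * (M%:R * c m * c m').
    rewrite mulr_sumr; apply: eq_bigr => m _.
    rewrite (bigD1 m)//= eqxx mul1r big1 ?addr0 ?expr2 ?mulrA// => m'.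
    by rewrite eq_sym => /negbTE ->; rewrite mul0r.
  apply: (@le_trans _ _ (C0 + \sum_m \sum_m' c m * c m' * S m m' M)); last first.
    rewrite lerD2l.
    rewrite [leLHS](_ : _ = \sum_(n < M) \prod_i (cos (pi * x n i) ^+ 2) ^+ p).
      apply: (@le_trans _ _ (\sum_(n < M) Q ^+ p)); first by apply: ler_sum.
      by rewrite sumr_const card_ord mulr_natl.
    under [RHS]eq_bigr do rewrite -cos_kernel_expansion.
    rewrite [RHS]exchange_big /=; apply: eq_bigr => m _.
    rewrite [RHS]exchange_big /=; apply: eq_bigr => m' _.
    by rewrite /S mulr_sumr.
  rewrite -big_split; apply: ler_sum => m _.
  rewrite -big_split; apply: ler_sum => m' _ /=.
  have cc : 0 <= c m * c m' by rewrite mulr_ge0 ?binom_weight_ge0.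
  have [<-|mm'] := eqVneq m m'.
    rewrite mul1r; have -> : S m m M = M%:R.
      rewrite /S (eq_bigr (fun=> 1)) ?sumr_const ?card_ord// => n _.
      by rewrite big1 ?mulr0 ?cos0// => i _; rewrite subrr mul0r.
    by rewrite -mulrA [leLHS]mulrC lerDr mulr_ge0 ?normr_ge0 ?mulr_ge0 ?binom_weight_ge0.
  rewrite mul0r -mulrDr mulr_ge0//.
  have := hC (m, m') mm' M; rewrite ler_norml => /andP[+ _] /=.
  by have := ler_norm (C (m, m')); lra.
have W0 : 0 < W - Q ^+ p by rewrite subr_gt0.
have := bound (Num.truncn (C0 / (W - Q ^+ p))).+1.
by rewrite -ler_pdivlMr// leNgt truncnS_gt.
Qed.

End kronecker.

(** * Directional derivatives *)

Section directional.
Variable R : realType.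

Lemma near_ball (V : normedModType R) (x : V) (P : V -> Prop) :
  (\forall y \near x, P y) ->
  exists r : R, 0 < r /\ forall y, `|y - x| < r -> P y.
Proof.
move=> /nbhs_normP[r /= r0 h]; exists r; split => // y yx; apply: h => /=.
by rewrite /ball_/= distrC.
Qed.

Lemma near_ball2 (V : normedModType R) (x : V) (P Q : V -> Prop) :
  (\forall y \near x, P y) -> (\forall y \near x, Q y) ->
  exists r : R, 0 < r /\ forall y, `|y - x| < r -> P y /\ Q y.
Proof. by move=> p q; apply: near_ball; exact: filterI. Qed.

(** A directional derivative depends only on the values along a line, and can
therefore be moved between a space, its affine lines, the slices of a product,
and translates. *)
Lemma is_derive_transfer (V1 V2 W : normedModType R) (f : V1 -> W) (g : V2 -> W)
    (a v : V1) (b w : V2) (d : W) :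
  (forall h : R, f (h *: v + a) = g (h *: w + b)) ->
  is_derive a v f d -> is_derive b w g d.
Proof.
move=> fg [df dv].
have E : (fun h : R => h^-1 *: ((f \o shift a) (h *: v) - f a)) =
         (fun h : R => h^-1 *: ((g \o shift b) (h *: w) - g b)).
  by apply/funext => h /=; have := fg 0; rewrite !scale0r !add0r => <-; rewrite fg.
by split; move: df dv; rewrite /derivable /derive E.
Qed.

Lemma is_derive_line (V W : normedModType R) (f : V -> W) (x v : V) (s : R) (d : W) :
  is_derive (x + s *: v) v f d -> is_derive s 1 (fun s => f (x + s *: v)) d.
Proof.
apply: is_derive_transfer => h.
by congr f; rewrite [h *: 1]mulr1 scalerDl addrCA.
Qed.

(** The inner map is derivable in one direction only.  Restricted to a line it
becomes a function of one variable, for which derivability is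
differentiability and the usual chain rule applies. *)
Lemma is_derive_chain (V W : normedModType R) (f : W -> R) (g : V -> W)
    (x v : V) (d : W) :
  differentiable f (g x) -> is_derive x v g d ->
  is_derive x v (f \o g) ('D_d f (g x)).
Proof.
move=> df dg.
pose l (s : R) := g (x + s *: v).
have l0 : l 0 = g x by rewrite /l scale0r addr0.
have dl : is_derive (0 : R) 1 l d.
  by apply: is_derive_line; rewrite scale0r addr0.
have diffl : differentiable l (0 : R) by apply/derivable1_diffP; case: dl.
rewrite -l0 in df *.
have dc := differentiable_comp diffl df.
have : is_derive (0 : R) 1 (f \o l) ('D_d f (l 0)).
  split; first exact: diff_derivable.
  by rewrite deriveE// diff_comp//= -(deriveE _ diffl) derive_val deriveE.
by apply: is_derive_transfer => h /=; rewrite addr0 [h *: 1]mulr1 /l addrC.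
Qed.

Lemma derive_lincomb (V : normedModType R) (f : V -> R) m (e : 'I_m -> V)
    (w : 'I_m -> R) (x : V) :
  differentiable f x ->
  'D_(\sum_j w j *: e j) f x = \sum_j w j * 'D_(e j) f x.
Proof.
move=> df; rewrite deriveE// linear_sum; apply: eq_bigr => j _.
by rewrite linearZ deriveE.
Qed.

Lemma mvt_line (V : normedModType R) (f : V -> R) (x v : V) :
  (forall s : R, 0 <= s <= 1 -> derivable f (x + s *: v) v) ->
  exists s : R, 0 <= s <= 1 /\ f (x + v) - f x = 'D_v f (x + s *: v).
Proof.
move=> df; pose g (s : R) := f (x + s *: v).
pose dg (s : R) := 'D_v f (x + s *: v).
have gd (s : R) : s \in `[0, 1] -> is_derive s 1 g (dg s).
  by rewrite in_itv/= => /df ds; apply: is_derive_line; exact: derivableP.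
have h01 : (0 : R) <= 1 by [].
have gd' (s : R) : s \in `]0, 1[ -> is_derive s 1 g (dg s).
  by move=> /subset_itv_oo_cc/gd.
have cg : {within `[0, 1], continuous g}.
  by apply: derivable_within_continuous => s /gd[].
have [s s01 E] := MVT_segment h01 gd' cg.
exists s; split; first by move: s01; rewrite in_itv.
by move: E; rewrite /g scale1r scale0r addr0 subr0 mulr1.
Qed.

Lemma is_derive_scale (V : normedModType R) (f : V -> R) (x v : V) (h : R) :
  derivable f x v -> is_derive x (h *: v) f (h * 'D_v f x).
Proof.
move=> df; pose l (s : R) := f (x + s *: v).
have dl : is_derive (0 : R) 1 l ('D_v f x).
  by apply: is_derive_line; rewrite scale0r addr0; exact: derivableP.
have diffl : differentiable l (0 : R) by apply/derivable1_diffP; case: dl.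
have : is_derive (0 : R) h l (h * 'D_v f x).
  split; first exact: diff_derivable.
  have -> : h = h *: (1 : R) by rewrite [RHS]mulr1.
  by rewrite deriveE// linearZ -(deriveE _ diffl) derive_val [_ *: 1]mulr1.
by apply: is_derive_transfer => k; rewrite addr0 /l scalerA addrC.
Qed.

Lemma is_derive_translate (V W : normedModType R) (f : V -> W) (x v c : V) (d : W) :
  is_derive (x + c) v f d -> is_derive x v (fun y => f (y + c)) d.
Proof. by apply: is_derive_transfer => h; rewrite addrA. Qed.

(** The mean value theorem, applied in direction [u] to the increment of [f]
in direction [v], and then in direction [v] to ['D_u f]. *)
Lemma second_difference (V : normedModType R) (f : V -> R) (u v x : V) (h : R) :
  (forall y, derivable f y u) -> (forall y, derivable ('D_u f) y v) ->
  exists s t : R, [/\ 0 <= s <= 1, 0 <= t <= 1 &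
    f (x + h *: u + h *: v) - f (x + h *: u) - (f (x + h *: v) - f x) =
    h ^+ 2 * 'D_v ('D_u f) (x + s *: (h *: u) + t *: (h *: v))].
Proof.
move=> du dv.
pose F y := f (y + h *: v) - f y.
have dF y : is_derive y (h *: u) F (h * 'D_u f (y + h *: v) - h * 'D_u f y).
  apply: is_deriveB; last exact: is_derive_scale.
  by apply: is_derive_translate; exact: is_derive_scale.
have [|s [s01]] := mvt_line V F x (h *: u); first by move=> s _; case: (dF (x + s *: (h *: u))).
rewrite (@derive_val _ _ _ _ _ _ _ (dF _)) -mulrBr => Es.
have dD y : is_derive y (h *: v) ('D_u f) (h * 'D_v ('D_u f) y).
  exact: is_derive_scale.
have [|t [t01]] := mvt_line V ('D_u f) (x + s *: (h *: u)) (h *: v).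
  by move=> t _; case: (dD (x + s *: (h *: u) + t *: (h *: v))).
rewrite (@derive_val _ _ _ _ _ _ _ (dD _)) => Et.
by exists s, t; split => //; rewrite expr2 -mulrA -Et -Es.
Qed.

(** The second difference is symmetric in [u] and [v], so both mixed
derivatives take a common value at points arbitrarily close to [x]. *)
Lemma schwarz (V : normedModType R) (f : V -> R) (u v x : V) :
  (forall y, derivable f y u) -> (forall y, derivable f y v) ->
  (forall y, derivable ('D_u f) y v) -> (forall y, derivable ('D_v f) y u) ->
  {for x, continuous ('D_v ('D_u f))} -> {for x, continuous ('D_u ('D_v f))} ->
  'D_v ('D_u f) x = 'D_u ('D_v f) x.
Proof.
move=> du dv duv dvu cuv cvu.
apply/eqP; rewrite -subr_eq0 -normr_le0; apply/ler_addgt0Pl => eps e0; rewrite addr0.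
have e20 : 0 < eps / 2 by rewrite divr_gt0.
have /cvgrPdist_lt/(_ _ e20) := cuv; have /cvgrPdist_lt/(_ _ e20) := cvu.
move=> Hvu Huv; have [r [r0 Hr]] := near_ball2 V x _ _ Huv Hvu.
set N := `|u| + `|v| + 1.
have N0 : 0 < N by rewrite ltr_wpDl// addr_ge0.
have [h h0 hN] : exists2 h : R, 0 < h & h * N < r.
  exists (r / (2 * N)); first by rewrite divr_gt0// mulr_gt0.
  by rewrite invfM mulrA mulfVK ?gt_eqF//; lra.
have near_x (a b : V) (s t : R) : `|a| + `|b| = `|u| + `|v| -> 0 <= s <= 1 -> 0 <= t <= 1 ->
    `|x + s *: (h *: a) + t *: (h *: b) - x| < r.
  move=> ab /andP[s0 s1] /andP[t0 t1].
  rewrite -(addrA x) (addrC x) addrK.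
  apply: (le_lt_trans (ler_normD _ _)); rewrite !normrZ (ger0_norm s0) (ger0_norm t0) (gtr0_norm h0).
  apply: (@le_lt_trans _ _ (h * `|a| + h * `|b|)).
    by apply: lerD; rewrite ler_piMl// mulr_ge0// ltW.
  rewrite -mulrDr ab; apply: le_lt_trans hN.
  by rewrite ler_pM2l// lerDl.
have [s [t [s01 t01 E1]]] := second_difference V f u v x h du duv.
have [s' [t' [s'01 t'01 E2]]] := second_difference V f v u x h dv dvu.
have [A _] := Hr _ (near_x u v _ _ erefl s01 t01).
have [_ B] := Hr _ (near_x v u _ _ (addrC _ _) s'01 t'01).
move: A B E1 E2; rewrite [x + h *: v + _]addrAC.
move: ('D_v ('D_u f) (x + _ + _)) ('D_u ('D_v f) (x + _ + _)).
move: ('D_v ('D_u f) x) ('D_u ('D_v f) x).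
move: (f (x + h *: u + h *: v)) (f (x + h *: u)) (f (x + h *: v)) (f x).
move=> F1 F2 F3 F4 p q d1 d2 A B E1 E2.
have E : d1 = d2.
  apply: (@mulfI _ (h ^+ 2)); first by rewrite expf_neq0 ?gt_eqF.
  by rewrite -E1 -E2; ring.
rewrite -E in B; rewrite (splitr eps).
by apply: (le_trans (ler_distD d1 _ _)); rewrite lerD// ltW// distrC.
Qed.

(** The increment of [g] is [O(h)], hence that of [D] is [O(h ^ 2)]. *)
Lemma derive0_of_quadratic (V W : normedModType R) (D : V -> R) (g : V -> W)
    (x v : V) (M d : R) : 0 < d -> 0 <= M -> derivable g x v ->
  (forall h : R, `|g (h *: v + x) - g x| < d ->
     `|D (h *: v + x) - D x| <= M * `|g (h *: v + x) - g x| ^+ 2) ->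
  is_derive x v D 0.
Proof.
move=> d0 M0 dg hD.
set l := 'D_v g x.
have gl : (fun h : R => h^-1 *: ((g \o shift x) (h *: v) - g x)) @ 0^' --> l by [].
pose B := `|l| + 1; have B0 : 0 < B by rewrite ltr_wpDl.
have lim0 : (fun h : R => h^-1 *: ((D \o shift x) (h *: v) - D x)) @ 0^' --> (0 : R).
  apply/cvgrPdist_le => eps e0.
  have n1 : \forall h \near 0^', `|l - h^-1 *: ((g \o shift x) (h *: v) - g x)| < 1.
    by have /cvgrPdist_lt/(_ 1 ltr01) := gl.
  near=> h; rewrite sub0r normrN.
  have hN0 : h != 0 by near: h; exact: nbhs_dnbhs_neq.
  have h1 : `|h| < d / B by near: h; apply: dnbhs0_lt; rewrite divr_gt0.
  have h2 : `|h| < eps / (M * B ^+ 2 + 1).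
    by near: h; apply: dnbhs0_lt; rewrite divr_gt0// ltr_wpDl// mulr_ge0// exprn_ge0// ltW.
  have h3 : `|h^-1 *: ((g \o shift x) (h *: v) - g x)| < B.
    rewrite /B -ltrBlDl; apply: (le_lt_trans (lerB_dist _ _)); rewrite distrC.
    by near: h.
  have gB : `|g (h *: v + x) - g x| <= `|h| * B.
    move: h3; rewrite /= normrZ normfV ltr_pdivrMl ?normr_gt0// => h3.
    exact: ltW.
  have small : `|g (h *: v + x) - g x| < d.
    by apply: (le_lt_trans gB); rewrite -ltr_pdivlMr.
  rewrite normrZ normfV ler_pdivrMl ?normr_gt0//=.
  apply: (le_trans (hD h small)).
  apply: (@le_trans _ _ (M * (`|h| * B) ^+ 2)).
    by rewrite ler_wpM2l// lerXn2r ?nnegrE ?mulr_ge0 ?(ltW B0).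
  rewrite (_ : M * (`|h| * B) ^+ 2 = `|h| * (`|h| * (M * B ^+ 2))); last by ring.
  rewrite ler_wpM2l//.
  move: h2; rewrite ltr_pdivlMr ?ltr_wpDl ?mulr_ge0 ?exprn_ge0 ?(ltW B0)//.
  by rewrite mulrDr mulr1; have := normr_ge0 h; lra.
split; first by apply/cvg_ex; exists (0 : R); exact: lim0.
by apply/cvg_lim.
Unshelve. all: by end_near. Qed.

End directional.

(** * Taylor estimates *)

Section taylor.
Variable R : realType.

Lemma norm_coord p q (w : 'M[R]_(p, q)) i j : `|w i j| <= `|w|.
Proof.
rewrite [leRHS]/Num.Def.normr/= mx_normrE.
exact: (le_bigmax _ (fun ij => `|w ij.1 ij.2|) (i, j)).
Qed.

Lemma norm_le_coord p q (w : 'M[R]_(p, q)) (c : R) : 0 <= c ->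
  (forall i j, `|w i j| <= c) -> `|w| <= c.
Proof.
move=> c0 h; rewrite [leLHS]/Num.Def.normr/= mx_normrE.
by apply: bigmax_le => // -[i j] _; exact: h.
Qed.

(** Estimates are needed only for increments in the span of a family [e]: all
directions for the primitive one-form, but only the space directions for the
time-dependent Hamiltonian. *)
Definition lincomb (V : normedModType R) m (e : 'I_m -> V) (w : 'cV[R]_m) : V :=
  \sum_j w j ord0 *: e j.

Lemma norm_lincomb (V : normedModType R) m (e : 'I_m -> V) (w : 'cV[R]_m) :
  `|lincomb V m e w| <= (\sum_j `|e j|) * `|w|.
Proof.
apply: (le_trans (ler_norm_sum _ _ _)); rewrite mulr_suml; apply: ler_sum => j _.
by rewrite normrZ mulrC ler_wpM2l// norm_coord.
Qed.

Lemma lincombZ (V : normedModType R) m (e : 'I_m -> V) (s : R) (w : 'cV[R]_m) :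
  lincomb V m e (s *: w) = s *: lincomb V m e w.
Proof.
by rewrite /lincomb scaler_sumr; apply: eq_bigr => j _; rewrite mxE scalerA.
Qed.

(** Uniform in [s], so that the whole segment lies in the ball. *)
Lemma lincomb_ball (V : normedModType R) m (e : 'I_m -> V) (z0 : V) (r : R) : 0 < r ->
  exists d : R, 0 < d /\ forall z (w : 'cV[R]_m) (s : R), `|z - z0| < d -> `|w| < d ->
    0 <= s <= 1 -> `|z + s *: lincomb V m e w - z0| < r.
Proof.
move=> r0; set N := \sum_j `|e j| + 1.
have N0 : 0 < N by rewrite ltr_wpDl// sumr_ge0.
have N1 : 0 < N + 1 by rewrite addr_gt0.
exists (r / (N + 1)); split; first by rewrite divr_gt0.
move=> z w s; rewrite !ltr_pdivlMr// => hz hw /andP[s0 s1].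
rewrite addrAC; apply: (le_lt_trans (ler_normD _ _)).
have : `|s *: lincomb V m e w| <= N * `|w|.
  rewrite normrZ (ger0_norm s0).
  apply: (@le_trans _ _ `|lincomb V m e w|); first by rewrite ler_piMl.
  by apply: (le_trans (norm_lincomb _ _ _ _)); rewrite ler_wpM2r// lerDl.
move: `|s *: _| `|z - z0| `|w| (normr_ge0 w) (normr_ge0 (z - z0)) hz hw => x y t t0 y0 hz hw hx.
have [ht|ht] := leP t y; nra.
Qed.

Lemma local_lipschitz (V : normedModType R) (A : set V) (f : V -> R) m (e : 'I_m -> V)
    (df : 'I_m -> V -> R) (z0 : V) :
  open A -> A z0 ->
  (forall x, A x -> differentiable f x) ->
  (forall j x, A x -> 'D_(e j) f x = df j x) ->
  (forall j, {for z0, continuous (df j)}) ->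
  exists r L : R, [/\ 0 < r, 0 <= L & forall z (w : 'cV[R]_m),
    `|z - z0| < r -> `|w| < r ->
    `|f (z + lincomb V m e w) - f z| <= L * `|w|].
Proof.
move=> oA Az0 diff_f dfE cdf.
have : \forall y \near z0, A y /\ forall j, `|df j z0 - df j y| < 1.
  apply: filterI; first exact: open_nbhs_nbhs.
  apply: filter_forall => j.
  by have /cvgrPdist_lt/(_ 1 ltr01) := cdf j.
move=> /near_ball[r [r0 hr]].
have [d [d0 hd]] := lincomb_ball V m e z0 r r0.
exists d, (\sum_j (`|df j z0| + 1)); split => //.
  by apply: sumr_ge0 => j _; rewrite addr_ge0.
move=> z w hz hw.
have in_ball (s : R) : 0 <= s <= 1 -> `|z + s *: lincomb V m e w - z0| < r by exact: hd.
have [|s [s01 ->]] := mvt_line R V f z (lincomb V m e w).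
  by move=> s /in_ball/hr[As _]; apply: diff_derivable; exact: diff_f.
have [As hs] := hr _ (in_ball s s01).
rewrite derive_lincomb; last exact: diff_f.
apply: (le_trans (ler_norm_sum _ _ _)); rewrite mulr_suml; apply: ler_sum => j _.
rewrite normrM mulrC ler_pM// ?norm_coord// dfE//.
move: (hs j); move: (df j z0) (df j (z + s *: lincomb V m e w)) => a b h.
by rewrite -lerBlDl (le_trans (lerB_dist _ _))// distrC ltW.
Qed.

(** The derivatives are named explicitly because for a component of a
vector-valued map they agree with the components of the derivatives only where
the map is derivable. *)
Definition C2_with (V : normedModType R) (A : set V) (f : V -> R)
    (D1 : V -> V -> R) (D2 : V -> V -> V -> R) :=
  [/\ forall x, A x -> differentiable f x,
      forall v x, A x -> 'D_v f x = D1 v x,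
      forall v x, A x -> differentiable (D1 v) x,
      forall v w x, A x -> 'D_w (D1 v) x = D2 v w x &
      forall v w x, A x -> {for x, continuous (D2 v w)}].

Lemma local_taylor (V : normedModType R) (A : set V) (f : V -> R) D1 D2
   m (e : 'I_m -> V) (z0 : V) :
  open A -> A z0 -> C2_with V A f D1 D2 ->
  exists r L : R, [/\ 0 < r, 0 <= L & forall z (w : 'cV[R]_m),
    `|z - z0| < r -> `|w| < r ->
    [/\ A (z + lincomb V m e w),
     `|f (z + lincomb V m e w) - f z| <= L * `|w|,
     forall j, `|D1 (e j) (z + lincomb V m e w) - D1 (e j) z| <= L * `|w| &
     `|f (z + lincomb V m e w) - f z - \sum_j w j ord0 * D1 (e j) z| <= L * `|w| ^+ 2]].
Proof.
move=> oA Az0 [fd fD1 D1d D1D2 D2c].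
have [r1 [L1 [r10 L10 h1]]] := local_lipschitz V A f m e (fun j => D1 (e j)) z0 oA Az0 fd
  (fun j x Ax => fD1 (e j) x Ax) (fun j => differentiable_continuous (D1d _ _ Az0)).
have lipD j : exists rL : R * R, [/\ 0 < rL.1, 0 <= rL.2 & forall z (w : 'cV[R]_m),
    `|z - z0| < rL.1 -> `|w| < rL.1 ->
    `|D1 (e j) (z + lincomb V m e w) - D1 (e j) z| <= rL.2 * `|w|].
  have [r [L h]] := local_lipschitz V A (D1 (e j)) m e (fun k => D2 (e j) (e k)) z0 oA Az0
    (D1d _) (fun k x Ax => D1D2 (e j) (e k) x Ax) (fun k => D2c _ _ _ Az0).
  by exists (r, L).
have {lipD}[rL hrL] := choice lipD.
have [r2 [r20 hA]] := near_ball R V z0 A (open_nbhs_nbhs (conj oA Az0)).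
have [d [d0 hd]] := lincomb_ball V m e z0 r2 r20.
(* A radius valid for [f], for each first derivative, and for staying in [A]. *)
pose r := \big[Num.min/Num.min r1 d]_j (rL j).1.
pose L := L1 + \sum_j (rL j).2.
have L2 j : (rL j).2 <= \sum_j (rL j).2.
  by rewrite (bigD1 j)//= lerDl sumr_ge0// => k _; case: (hrL k).
have sL0 : 0 <= \sum_j (rL j).2 by rewrite sumr_ge0// => k _; case: (hrL k).
exists r, L; split.
- rewrite /r; elim/big_ind : _ => [|x y x0 y0|j _]; rewrite ?lt_min ?r10 ?d0 ?x0 ?y0//.
  by case: (hrL j).
- by rewrite addr_ge0.
move=> z w.
have rj j : r <= (rL j).1 by rewrite /r; exact: bigmin_le.
have rb : r <= Num.min r1 d by rewrite /r; exact: bigmin_le_id.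
move=> hz hw.
have [hz1 hzd] : `|z - z0| < r1 /\ `|z - z0| < d.
  by move: (lt_le_trans hz rb); rewrite lt_min => /andP.
have [hw1 hwd] : `|w| < r1 /\ `|w| < d.
  by move: (lt_le_trans hw rb); rewrite lt_min => /andP.
have inA (s : R) : 0 <= s <= 1 -> A (z + s *: lincomb V m e w).
  by move=> s01; apply: hA; exact: hd.
have lipL j (s : R) : 0 <= s <= 1 ->
   `|D1 (e j) (z + s *: lincomb V m e w) - D1 (e j) z| <= (rL j).2 * `|w|.
  move=> /andP[s0 s1]; have [_ l0 hj] := hrL j.
  have sw : `|s *: w| <= `|w| by rewrite normrZ (ger0_norm s0) ler_piMl.
  rewrite -lincombZ; apply: le_trans (hj z (s *: w) _ _) _.
  - exact: lt_le_trans hz (rj j).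
  - exact: le_lt_trans sw (lt_le_trans hw (rj j)).
  - by rewrite ler_wpM2l.
split.
- by have := inA 1; rewrite scale1r; apply; rewrite ler01 lexx.
- apply: le_trans (h1 z w hz1 hw1) _; rewrite ler_wpM2r// lerDl.
  by apply: sumr_ge0 => j _; case: (hrL j).
- move=> j; have := lipL j 1; rewrite scale1r ler01 lexx => /(_ isT) h.
  apply: (le_trans h); rewrite ler_wpM2r// (le_trans (L2 j))// lerDr//.
have [|s [s01 ->]] := mvt_line R V f z (lincomb V m e w).
  by move=> s /inA As; apply: diff_derivable; exact: fd.
rewrite derive_lincomb; last exact/fd/inA.
rewrite -sumrB; apply: (le_trans (ler_norm_sum _ _ _)).
apply: (@le_trans _ _ (\sum_j (rL j).2 * `|w| ^+ 2)); last first.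
  by rewrite -mulr_suml ler_wpM2r ?exprn_ge0// lerDr.
apply: ler_sum => j _; rewrite fD1; last exact: inA.
rewrite -mulrBr normrM expr2 mulrA mulrC ler_pM ?norm_coord//.
exact: lipL.
Qed.

End taylor.

(** * Components and matrix inverses *)

Section coordinates.
Variable R : realType.

Lemma C2_scalar (V : normedModType R) (A : set V) (f : V -> R) :
  class_C 2 A (f : V -> R^o) ->
  C2_with R V A f (fun v x => 'D_v f x) (fun v w x => 'D_w ('D_v f) x).
Proof.
move=> [fd fD]; split => //.
- by move=> v x Ax; have [h _] := fD v; exact: h.
- by move=> v w x Ax; have [_ h] := fD v; exact: h.
Qed.

Lemma differentiable_entry (V : normedModType R) p q (f : V -> 'M[R]_(p, q)) x i j :
  differentiable f x -> differentiable (fun y => f y i j) x.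
Proof.
move=> df.
have dc := @differentiable_coord R _ _ (f x) i j.
exact: (differentiable_comp df dc).
Qed.

Lemma derive_entry (V : normedModType R) p q (f : V -> 'M[R]_(p, q)) x v i j :
  derivable f x v -> 'D_v (fun y => f y i j) x = 'D_v f x i j.
Proof. by move=> df; rewrite derive_mx// mxE. Qed.

Lemma continuous_entry (V : topologicalType) p q (f : V -> 'M[R]_(p, q)) x i j :
  {for x, continuous f} -> {for x, continuous (fun y => f y i j)}.
Proof.
move=> cf; apply: (@continuous_comp _ _ _ f (fun M : 'M[R]_(p, q) => M i j)) => //.
exact: coord_continuous.
Qed.

Lemma C2_coord (V : normedModType R) (A : set V) p (f : V -> 'cV[R]_p) i :
  open A -> class_C 2 A f ->
  C2_with R V A (fun x => f x i ord0) (fun v x => 'D_v f x i ord0)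
    (fun v w x => 'D_w ('D_v f) x i ord0).
Proof.
move=> oA [fd fD]; split.
- by move=> x Ax; apply: differentiable_entry; exact: fd.
- by move=> v x Ax; apply: derive_entry; apply: diff_derivable; exact: fd.
- by move=> v x Ax; have [h _] := fD v; apply: differentiable_entry; exact: h.
- move=> v w x Ax; have [h _] := fD v.
  by apply: derive_entry; apply: diff_derivable; exact: h.
- by move=> v w x Ax; have [_ h] := fD v; apply: continuous_entry; exact: h.
Qed.

Lemma continuous_det (T : topologicalType) p (A : T -> 'M[R]_p) t :
  (forall i j, {for t, continuous (fun s => A s i j)}) ->
  {for t, continuous (fun s => \det (A s))}.
Proof.
move=> cA; rewrite /determinant.
apply: (cvg_big (op := +%R)) => [|s _]; first exact: add_continuous.
apply: cvgM; first exact: cvg_cst.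
have mc : continuous (fun x : R * R => x.1 * x.2) by exact: mul_continuous.
have := @cvg_big R 'I_p _ 1 xpredT mc T (nbhs t) (index_enum _) (fun i x => A x i (s i)) (fun i => A t i (s i)) _; apply => i _.
exact: cA.
Qed.

Lemma continuous_invmx (T : topologicalType) p (A : T -> 'M[R]_p) t :
  (forall i j, {for t, continuous (fun s => A s i j)}) ->
  (\forall s \near t, A s \in unitmx) ->
  forall i j, {for t, continuous (fun s => invmx (A s) i j)}.
Proof.
move=> cA uA i j.
have E : \forall s \near t, (\det (A s))^-1 * cofactor (A s) j i = invmx (A s) i j.
  by apply: filterS uA => s us; rewrite /invmx us !mxE.
have Et := nbhs_singleton E.
rewrite /prop_for /continuous_at -Et.
apply: cvg_trans; first exact: (near_eq_cvg E).
apply: cvgM.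
  apply: cvgV; last exact: continuous_det.
  by have := nbhs_singleton uA; rewrite unitmxE unitfE.
rewrite /cofactor; apply: cvgM; first exact: cvg_cst.
have := @continuous_det T _ (fun s => row' j (col' i (A s))) t; apply => k l.
by rewrite /prop_for /continuous_at !mxE; under eq_cvg do rewrite !mxE; exact: cA.
Qed.

End coordinates.

(** * Curves over a compact time interval *)

Section real_line.
Variable R : realType.

(** Compactness of the segment, in a form in which [C] plays the role of a
constant that may be enlarged finitely many times. *)
Lemma uniform_on_segment (T : R) (P : R -> R -> Prop) :
  (forall t0 : R, 0 <= t0 <= T -> exists r C0 : R, 0 < r /\
     forall t C : R, 0 <= t <= T -> `|t - t0| < r -> C0 <= C -> P C t) ->
  \forall C \near +oo, forall t : R, 0 <= t <= T -> P C t.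
Proof.
move=> h.
have /compact_near_coveringP/near_covering_withinP cov := @segment_compact R 0 T.
have E : \forall C \near +oo, `[0, T] `<=` P C.
  apply: cov => t0; rewrite /= in_itv/= => /h[r [C0 [r0 hP]]].
  exists (ball t0 r, [set C | C0 <= C]).
    by split; [exact: nbhsx_ballx | apply: nbhs_pinfty_ge; exact: num_real].
  move=> [t C] /= [bt hC]; rewrite in_itv/= => tT; apply: hP => //.
  by move: bt; rewrite -ball_normE /ball_/= distrC.
by apply: filterS E => C hC t tT; apply: hC; rewrite /= in_itv.
Qed.

Lemma antiderivative (f : R -> R) (T : R) (J : set R) : 0 < T ->
  open J -> is_interval J -> J 0 -> J T ->
  (forall t, J t -> {for t, continuous f}) ->
  exists S : R -> R, forall t, 0 <= t <= T -> is_derive t 1 S (f t).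
Proof.
move=> T0 oJ iJ J0 JT cf.
have [r1 [r10 h1]] := near_ball R R 0 J (open_nbhs_nbhs (conj oJ J0)).
have [r2 [r20 h2]] := near_ball R R T J (open_nbhs_nbhs (conj oJ JT)).
pose c := - (r1 / 2); pose u := T + r2 / 2.
have Jc : J c by apply: h1; rewrite subr0 normrN gtr0_norm; lra.
have Ju : J u by apply: h2; rewrite /u addrAC subrr add0r gtr0_norm; lra.
have Jcu t : t \in `[c, u] -> J t.
  by rewrite in_itv/= => tcu; apply: (iJ c u).
have int : (@lebesgue_measure R).-integrable `[c, u] (EFin \o f).
  apply: continuous_compact_integrable; first exact: segment_compact.
  apply: continuous_in_subspaceT => t; rewrite inE => /Jcu; exact: cf.
exists (fun x => \int[@lebesgue_measure R]_(t in `[c, x]) f t)%R => t /andP[t0 tT].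
have ct : c < t by rewrite /c; lra.
have tu : t < u by rewrite /u; lra.
have Jt : J t by apply: Jcu; rewrite in_itv/= !ltW.
have [d1 d2] := continuous_FTC1_closed tu int ct (cf _ Jt).
by apply: DeriveDef; [exact: d1 | rewrite -derive1E; exact: d2].
Qed.

End real_line.

(** * Estimates along a tube *)

Section tube.
Variable R : realType.

(** The single large number [C] serves as the inverse radius of the tube around
the curve and as the constant of all the estimates. *)
Lemma tube_taylor (V : normedModType R) (A : set V) (f : V -> R) D1 D2
    m (e : 'I_m -> V) (T : R) (y : R -> V) :
  open A -> C2_with R V A f D1 D2 ->
  (forall t : R, 0 <= t <= T -> A (y t) /\ {for t, continuous y}) ->
  \forall C \near +oo, forall t : R, 0 <= t <= T ->
    forall w : 'cV[R]_m, `|w| < C^-1 ->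
    [/\ A (y t + lincomb R V m e w),
     `|f (y t + lincomb R V m e w) - f (y t)| <= C * `|w|,
     forall j, `|D1 (e j) (y t + lincomb R V m e w) - D1 (e j) (y t)| <= C * `|w| &
     `|f (y t + lincomb R V m e w) - f (y t) - \sum_j w j ord0 * D1 (e j) (y t)|
       <= C * `|w| ^+ 2].
Proof.
move=> oA fC2 hy; apply: uniform_on_segment => t0 /hy[Ay cy].
have [r [L [r0 L0 hr]]] := local_taylor R V A f D1 D2 m e (y t0) oA Ay fC2.
have [d [d0 hd]] : exists d : R, 0 < d /\ forall t, `|t - t0| < d -> `|y t0 - y t| < r.
  by apply: near_ball; have /cvgrPdist_lt/(_ r r0) := cy.
exists d, (Num.max L r^-1); split => // t C _ /hd hyt.
rewrite ge_max => /andP[LC rC] w wC.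
have C0 : 0 < C by apply: lt_le_trans rC; rewrite invr_gt0.
have wr : `|w| < r.
  by apply: lt_le_trans wC _; rewrite -[leRHS]invrK lef_pV2 ?posrE ?invr_gt0.
rewrite distrC in hyt; have [h1 h2 h3 h4] := hr (y t) w hyt wr.
split=> //; last by apply: le_trans h4 _; rewrite ler_wpM2r ?exprn_ge0.
  by apply: le_trans h2 _; rewrite ler_wpM2r.
by move=> j; apply: le_trans (h3 j) _; rewrite ler_wpM2r.
Qed.

Lemma bounded_on_segment (f : R -> R) (T : R) :
  (forall t : R, 0 <= t <= T -> {for t, continuous f}) ->
  \forall C \near +oo, forall t : R, 0 <= t <= T -> `|f t| <= C.
Proof.
move=> cf; apply: uniform_on_segment => t0 /cf cft.
have [d [d0 hd]] : exists d : R, 0 < d /\ forall t, `|t - t0| < d -> `|f t0 - f t| < 1.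
  by apply: near_ball; have /cvgrPdist_lt/(_ 1 ltr01) := cft.
exists d, (`|f t0| + 1); split => // t C _ /hd h; apply: le_trans.
by rewrite -lerBlDl (le_trans (lerB_dist _ _))// distrC ltW.
Qed.

Lemma norm_mulmx p (A : 'M[R]_p) (v : 'cV[R]_p) (c d : R) : 0 <= c -> 0 <= d ->
  (forall i j, `|A i j| <= c) -> `|v| <= d -> `|A *m v| <= p%:R * c * d.
Proof.
move=> c0 d0 hA hv; apply: norm_le_coord; first by rewrite !mulr_ge0.
move=> i j; rewrite mxE; apply: (le_trans (ler_norm_sum _ _ _)).
apply: (@le_trans _ _ (\sum_(k < p) c * d)).
  apply: ler_sum => k _; rewrite normrM ler_pM//.
  exact: le_trans (norm_coord _ _ _ _ _ _) hv.
by rewrite sumr_const card_ord -mulrA mulr_natl.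
Qed.

(** Subtraction of two linear systems.  The solution [w] of the second one
remains on the right, where it is multiplied by the small matrix [B - A]. *)
Lemma linear_systems_difference p (A B : 'M[R]_p) (v w g h : 'cV[R]_p) :
  A *m v = g -> B *m w = h -> A *m (w - v) = (h - g) - (B - A) *m w.
Proof. by move=> <- <-; rewrite mulmxBr mulmxBl opprB [RHS]addrC addrA subrK. Qed.

Lemma entryB p q (A B : 'M[R]_(p, q)) i j : (A - B) i j = A i j - B i j.
Proof. by rewrite !mxE. Qed.

Lemma dist_differences (x1 x2 y1 y2 c : R) : `|x1 - y1| <= c -> `|x2 - y2| <= c ->
  `|x1 - x2 - (y1 - y2)| <= 2 * c.
Proof.
move=> h1 h2; have -> : x1 - x2 - (y1 - y2) = (x1 - y1) - (x2 - y2) by ring.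
by rewrite (le_trans (ler_normB _ _))// mulr2n mulrDl mul1r lerD.
Qed.

(** The first variation of the action, at one instant.  Here [x] and [y] are two
curves, [u = y - x], [ax] and [ay] are the values of the one-form at [x] and
[y], and the left-hand side is the derivative of the difference of their
actions minus [a(x) . u].  Hamilton's equations, the second hypothesis, cancel
everything that is of first order in [u]; what remains on the right is a
product of two increments and two Taylor remainders. *)
Lemma first_variation p (ax ay dx dy u du : 'I_p -> R) (Da : 'I_p -> 'I_p -> R)
    (DH : 'I_p -> R) (Hx Hy : R) :
  (forall i, du i = dy i - dx i) ->
  (forall j, \sum_i (Da i j - Da j i) * dx i = DH j) ->
  (\sum_i ay i * dy i - Hy) - (\sum_i ax i * dx i - Hx)
    - \sum_i (ax i * du i + u i * \sum_j dx j * Da i j) =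
  \sum_i (ay i - ax i) * du i + \sum_i (ay i - ax i - \sum_j u j * Da i j) * dx i
   - (Hy - Hx - \sum_j u j * DH j).
Proof.
move=> duE ham.
have E : \sum_j u j * DH j =
    \sum_i (\sum_j u j * Da i j) * dx i - \sum_i u i * \sum_j dx j * Da i j.
  have -> : \sum_i (\sum_j u j * Da i j) * dx i =
      \sum_j \sum_i u j * Da i j * dx i.
    by rewrite exchange_big; apply: eq_bigr => i _; rewrite mulr_suml.
  rewrite -sumrB; apply: eq_bigr => j _; rewrite -ham !mulr_sumr -sumrB.
  by apply: eq_bigr => i _; ring.
rewrite E; apply/eqP; rewrite -subr_eq0; apply/eqP.
rewrite [X in X = _](_ : _ =
  \sum_i ay i * dy i - \sum_i ax i * dx i
    - \sum_i (ax i * du i + u i * \sum_j dx j * Da i j)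
    - \sum_i (ay i - ax i) * du i
    - \sum_i (ay i - ax i - \sum_j u j * Da i j) * dx i
    - \sum_i (\sum_j u j * Da i j) * dx i + \sum_i u i * \sum_j dx j * Da i j); last by ring.
rewrite -!sumrB -big_split big1//= => i _; rewrite duE; ring.
Qed.

End tube.

(** * Gronwall's inequality *)

Section gronwall.
Variable R : realType.

Lemma mvt_from0 (f df : R -> R) (T : R) : 0 <= T ->
  (forall t : R, 0 <= t <= T -> is_derive t 1 f (df t)) ->
  exists t : R, 0 <= t <= T /\ f T - f 0 = df t * T.
Proof.
move=> T0 fd.
have fd' (t : R) : t \in `]0, T[ -> is_derive t 1 f (df t).
  by move=> /subset_itv_oo_cc; rewrite in_itv; exact: fd.
have cf : {within `[0, T], continuous f}.
  by apply: derivable_within_continuous => t; rewrite in_itv => /fd[].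
have [t t0T E] := MVT_segment T0 fd' cf.
by exists t; split; [move: t0T; rewrite in_itv | rewrite E subr0].
Qed.

(** The differential inequality is available only below the barrier [r].  If
[E] reached [r], the inequality would hold up to the first time at which it
does, and would give a value smaller than [r] there. *)
Lemma gronwall (E dE : R -> R) (T c r : R) : 0 <= c -> 0 <= E 0 ->
  (forall t : R, 0 <= t <= T -> is_derive t 1 E (dE t)) ->
  (forall t : R, 0 <= t <= T -> E t < r -> dE t <= c * E t) ->
  E 0 * expR (c * T) < r ->
  forall t : R, 0 <= t <= T -> E t <= E 0 * expR (c * T).
Proof.
move=> c0 E0 dEd hE small.
have mono_exp (t : R) : t <= T -> E 0 * expR (c * t) <= E 0 * expR (c * T).
  by move=> tT; rewrite ler_wpM2l// ler_expR ler_wpM2l.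
have q_deriv (t : R) : 0 <= t <= T ->
    is_derive t 1 (fun s => E s * expR (- (c * s)))
      ((dE t - c * E t) * expR (- (c * t))).
  move=> tT; have dEt := dEd t tT.
  have de : is_derive t 1 (fun s => expR (- (c * s))) (expR (- (c * t)) * - c).
    have dn : is_derive t 1 (fun s : R => - (c * s)) (- c).
      have -> : (fun s : R => - (c * s)) = (- c) \*: id.
        by apply/funext => s /=; rewrite -mulNr.
      have := is_deriveZ (- c) (is_derive_id t (1 : R)).
      by rewrite [_ *: 1]mulr1.
    exact: (is_derive1_comp (is_derive_expR _) dn).
  have -> : (dE t - c * E t) * expR (- (c * t)) =
      E t *: (expR (- (c * t)) * - c) + expR (- (c * t)) *: dE t.
    by rewrite /GRing.scale /=; ring.
  exact: (is_deriveM dEt de).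
have step (t1 : R) : 0 <= t1 <= T -> (forall t : R, 0 <= t < t1 -> E t < r) ->
    E t1 <= E 0 * expR (c * t1).
  move=> /andP[t10 t1T] hlt; have [t1_le0|t1_gt0] := leP t1 0.
    have -> : t1 = 0 by apply/le_anti; rewrite t10 t1_le0.
    by rewrite mulr0 expR0 mulr1.
  have inT (s : R) : 0 <= s <= t1 -> 0 <= s <= T.
    by move=> /andP[-> st]; rewrite (le_trans st).
  pose q s := E s * expR (- (c * s)).
  pose dq t := (dE t - c * E t) * expR (- (c * t)).
  have qd (t : R) : t \in `]0, t1[ -> is_derive t 1 q (dq t).
    by move=> /subset_itv_oo_cc; rewrite in_itv => /inT; exact: q_deriv.
  have cq : {within `[0, t1], continuous q}.
    by apply: derivable_within_continuous => t; rewrite in_itv => /inT/q_deriv[].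
  have [s s01 Eq] := MVT t1_gt0 qd cq.
  have : q t1 <= q 0.
    rewrite -subr_le0 Eq subr0; apply: mulr_le0_ge0 => //.
    rewrite /dq; apply: mulr_le0_ge0; last exact: expR_ge0.
    move: s01; rewrite in_itv /= => /andP[s0 s1].
    rewrite subr_le0; apply: hE; first by apply: inT; rewrite !ltW.
    by apply: hlt; rewrite s1 ltW.
  rewrite /q mulr0 oppr0 expR0 mulr1 expRN.
  by rewrite ler_pdivrMr ?expR_gt0.
(* The first time at which the barrier is reached is the minimum of a compact
   set. *)
have below (t : R) : 0 <= t <= T -> E t < r.
  move=> tT; rewrite ltNge; apply/negP => rE.
  pose B := [set s : R | 0 <= s <= T /\ r <= E s].
  have cB : compact B.
    apply: (@subclosed_compact _ B `[0, T]); last 2 first.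
    - exact: segment_compact.
    - by move=> s []; rewrite /= in_itv.
    move=> s clBs; have sT : 0 <= s <= T.
      have : closure `[0, T] s.
        by apply: closure_subset clBs => u []; rewrite /= in_itv.
      have /closure_id <- := @interval_closed R (BLeft 0) (BRight T) isT isT.
      by rewrite /= in_itv.
    split => //; rewrite leNgt; apply/negP => Esr.
    have cs : {for s, continuous E}.
      by apply: differentiable_continuous; apply/derivable1_diffP; case: (dEd s sT).
    have nE : \forall u \near s, E u < r.
      by have := cvgr_lt (E s) cs; apply.
    by have [u [[_ ru] /=]] := clBs _ nE; rewrite ltNge ru.
  have [||s] := @compact_EVT_min _ R id B _ cB _.
  - by exists t.
  - by apply: continuous_subspaceT => z; exact: cvg_id.
  rewrite inE => -[sT rEs] smin.
  have : E s <= E 0 * expR (c * s).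
    apply: step => // u /andP[u0 us]; rewrite ltNge; apply/negP => rEu.
    have : s <= u.
      apply: smin; rewrite inE; split => //; rewrite u0 /=.
      by have /andP[_ sT'] := sT; rewrite (le_trans (ltW us)).
    by rewrite leNgt us.
  have /andP[_ sT'] := sT.
  move=> /le_trans/(_ (mono_exp s sT')) /le_lt_trans/(_ small).
  by rewrite ltNge rEs.
move=> t tT; have /andP[t0 tT'] := tT; apply: le_trans (mono_exp t tT').
apply: step => // s /andP[s0 st]; apply: below; rewrite s0 /=.
exact: le_trans (ltW st) tT'.
Qed.

(** [gronwall] for the squared Euclidean norm, which unlike the maximum norm is
differentiable; the two norms are equivalent up to the factor [p]. *)
Lemma vector_gronwall p (u du : R -> 'cV[R]_p) (T L rho : R) : 0 <= L -> 0 < rho ->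
  (forall t : R, 0 <= t <= T -> is_derive t 1 u (du t)) ->
  (forall t : R, 0 <= t <= T -> `|u t| < rho -> `|du t| <= L * `|u t|) ->
  p%:R * `|u 0| ^+ 2 * expR (2 * p%:R * L * T) < rho ^+ 2 ->
  forall t : R, 0 <= t <= T ->
    `|u t| ^+ 2 <= p%:R * expR (2 * p%:R * L * T) * `|u 0| ^+ 2 /\ `|u t| < rho.
Proof.
move=> L0 rho0 ud hL small.
pose E t := \sum_i u t i ord0 ^+ 2.
pose dE t := \sum_i (u t i ord0 * du t i ord0 + u t i ord0 * du t i ord0).
have uE t : `|u t| ^+ 2 <= E t.
  have E0 : 0 <= E t by apply: sumr_ge0 => i _; exact: sqr_ge0.
  rewrite -(@ler_sqrt _ _ (E t))// sqrtr_sqr ger0_norm//.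
  apply: norm_le_coord; first exact: sqrtr_ge0.
  move=> i j; rewrite (ord1 j) -sqrtr_sqr ler_sqrt//.
  by rewrite /E (bigD1 i)//= lerDl sumr_ge0// => k _; exact: sqr_ge0.
have Eu t : E t <= p%:R * `|u t| ^+ 2.
  apply: (@le_trans _ _ (\sum_(i < p) `|u t| ^+ 2)).
    apply: ler_sum => i _; rewrite -real_normK ?num_real//.
    by rewrite lerXn2r ?nnegrE// norm_coord.
  by rewrite sumr_const card_ord mulr_natl.
have dEd (t : R) : 0 <= t <= T -> is_derive t 1 E (dE t).
  move=> /ud [dut Eut].
  have ui i : is_derive t 1 (fun s => u s i ord0) (du t i ord0).
    split; first by move/derivable_mxP : dut => /(_ i ord0).
    by rewrite derive_entry// Eut.
  have -> : E = \sum_i (fun s => u s i ord0) ^+ 2.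
    by apply/funext => s; rewrite fct_sumE.
  apply: is_derive_sum => i.
  have := is_deriveM (ui i) (ui i); rewrite /GRing.scale /=.
  by rewrite expr2.
have hE (t : R) : 0 <= t <= T -> E t < rho ^+ 2 -> dE t <= 2 * p%:R * L * E t.
  move=> tT Et; have ut : `|u t| < rho.
    by rewrite -(@ltr_pXn2r _ 2) ?nnegrE ?(ltW rho0)// (le_lt_trans (uE t)).
  apply: (@le_trans _ _ (\sum_(i < p) 2 * L * E t)); last first.
    by rewrite sumr_const card_ord -mulr_natl le_eqVlt; apply/orP; left; apply/eqP; ring.
  apply: ler_sum => i _.
  apply: (@le_trans _ _ (2 * (`|u t| * (L * `|u t|)))).
    have : u t i ord0 * du t i ord0 <= `|u t| * (L * `|u t|).
      apply: (le_trans (ler_norm _)); rewrite normrM ler_pM ?norm_coord//.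
      exact: le_trans (norm_coord _ _ _ _ _ _) (hL t tT ut).
    lra.
  have := ler_wpM2l L0 (uE t); lra.
have small' : E 0 * expR (2 * p%:R * L * T) < rho ^+ 2.
  apply: le_lt_trans small; rewrite ler_wpM2r ?expR_ge0//.
have E00 : 0 <= E 0 by apply: sumr_ge0 => i _; exact: sqr_ge0.
have c0 : 0 <= 2 * p%:R * L by rewrite !mulr_ge0.
move=> t tT; have Et := gronwall E dE T _ _ c0 E00 dEd hE small' t tT.
split.
  apply: le_trans (uE t) (le_trans Et _).
  by rewrite [leRHS]mulrAC ler_wpM2r ?expR_ge0.
rewrite -(@ltr_pXn2r _ 2) ?nnegrE ?(ltW rho0)//.
exact: le_lt_trans (uE t) (le_lt_trans Et small').
Qed.

End gronwall.

(** * Orbits of Hamiltonian systems and their action *)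

Section trajectories.
Variable R : realType.
Variables p l : nat.
Variables (U : set 'cV[R]_p) (oU : open U).
Variables (a : 'cV[R]_p -> 'cV[R]_p) (ha : class_C 2 U a).
Hypothesis hOmega : forall z, U z -> Omega a z \in unitmx.
Variable H : 'cV[R]_p * 'cV[R]_l -> R.
Hypothesis hH : class_C 2 (U `*` [set: 'cV[R]_l])
  (H : 'cV[R]_p * 'cV[R]_l -> R^o).
Variable alphahat : 'cV[R]_l.

Definition zdir (j : 'I_p) : 'cV[R]_p := delta_mx j ord0.
Definition hdir (j : 'I_p) : 'cV[R]_p * 'cV[R]_l := (delta_mx j ord0, 0).

Lemma lincomb_zdir (w : 'cV[R]_p) : lincomb R _ p zdir w = w.
Proof.
by rewrite [RHS]matrix_sum_delta /lincomb; apply: eq_bigr => i _; rewrite big_ord1.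
Qed.

Lemma lincomb_hdir (w : 'cV[R]_p) : lincomb R _ p hdir w = (w, 0).
Proof.
rewrite -[in RHS](lincomb_zdir w) /lincomb.
elim/big_ind2: _ => // [x1 x2 y1 y2 -> ->|j _].
  by congr pair; rewrite addr0.
by congr pair; rewrite scaler0.
Qed.

Lemma a_C2 i : C2_with R _ U (fun x => a x i ord0) (fun v x => 'D_v a x i ord0)
    (fun v w x => 'D_w ('D_v a) x i ord0).
Proof. exact: C2_coord. Qed.

Lemma H_C2 : C2_with R _ (U `*` [set: 'cV[R]_l]) H (fun v x => 'D_v H x)
  (fun v w x => 'D_w ('D_v H) x).
Proof. exact: C2_scalar. Qed.

Lemma open_phase_space : open (U `*` [set: 'cV[R]_l]).
Proof.
rewrite openE => -[z w] [/= Uz _]; exists (U, setT) => /=.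
  by split; [exact: open_nbhs_nbhs|exact: filterT].
by move=> [z' w'] [].
Qed.

Lemma DscalE z ph j : U z ->
  Dscal (fun y => H (y, ph)) z ord0 j = 'D_(hdir j) H (z, ph).
Proof.
move=> Uz; rewrite mxE; have [dH _ _ _ _] := H_C2.
have : is_derive (z, ph) (hdir j) H ('D_(hdir j) H (z, ph)).
  by apply: derivableP; apply: diff_derivable; exact: dH.
have tr : is_derive (z, ph) (hdir j) H ('D_(hdir j) H (z, ph)) ->
  is_derive z (delta_mx j ord0) (fun y => H (y, ph) : R^o) ('D_(hdir j) H (z, ph)).
  apply: is_derive_transfer => h /=; congr (H (_, _)).
  by rewrite -[(h *: hdir j).2]/(h *: (0 : 'cV[R]_l)) scaler0 add0r.
by move=> /tr [].
Qed.

Lemma DscalTE z ph j : U z ->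
  (Dscal (fun y => H (y, ph)) z)^T j ord0 = 'D_(hdir j) H (z, ph).
Proof. by move=> Uz; rewrite mxE DscalE. Qed.

Lemma OmegaE z i j : Omega a z i j = 'D_(zdir i) a z j ord0 - 'D_(zdir j) a z i ord0.
Proof. by rewrite !mxE. Qed.

(** Hamilton's equations with the matrix [Omega] on the left: in this form they
can be compared along two orbits without differentiating its inverse. *)
Definition traj (J : set R) (ph : 'cV[R]_l) (x dx : R -> 'cV[R]_p) :=
  forall t : R, J t -> [/\ U (x t), is_derive t 1 x (dx t) &
    Omega a (x t) *m dx t = (Dscal (fun y => H (y, ph + t *: alphahat)) (x t))^T].

Section one_trajectory.
Variables (J : set R) (ph : 'cV[R]_l) (x dx : R -> 'cV[R]_p).
Hypothesis (oJ : open J) (tr : traj J ph x dx).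

Lemma traj_diff t : J t -> differentiable x t.
Proof. by move=> /tr[_ [dv _] _]; apply/derivable1_diffP. Qed.

Lemma traj_cont t : J t -> {for t, continuous x}.
Proof. by move=> /traj_diff; exact: differentiable_continuous. Qed.

Definition phase_pt (t : R) : 'cV[R]_p * 'cV[R]_l := (x t, ph + t *: alphahat).

Lemma phase_pt_cont t : J t -> {for t, continuous phase_pt}.
Proof.
move=> Jt.
have c2 : {for t, continuous (fun s : R => ph + s *: alphahat)}.
  by apply: cvgD; [exact: cvg_cst|exact: scalel_continuous].
exact: (cvg_pair (traj_cont t Jt) c2).
Qed.

Lemma Omega_cont t i j : J t -> {for t, continuous (fun s => Omega a (x s) i j)}.
Proof.
move=> Jt; have [Ux _ _] := tr t Jt.
have c u v : {for t, continuous (fun s => 'D_(zdir u) a (x s) v ord0)}.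
  have [_ _ D1d _ _] := a_C2 v.
  apply: (@continuous_comp _ _ _ x (fun z => 'D_(zdir u) a z v ord0)).
    exact: traj_cont.
  exact/differentiable_continuous/D1d.
have -> : (fun s => Omega a (x s) i j) =
    (fun s => 'D_(zdir i) a (x s) j ord0) \- (fun s => 'D_(zdir j) a (x s) i ord0).
  by apply/funext => s; rewrite OmegaE.
exact: (cvgB (c i j) (c j i)).
Qed.

Lemma near_Omega_unit t : J t -> \forall s \near t, Omega a (x s) \in unitmx.
Proof.
move=> Jt; have : \forall s \near t, J s by apply: open_nbhs_nbhs.
by apply: filterS => s /tr[/hOmega].
Qed.

Lemma dH_cont t j : J t -> {for t, continuous (fun s => 'D_(hdir j) H (phase_pt s))}.
Proof.
move=> Jt; have [Ux _ _] := tr t Jt; have [_ _ D1d _ _] := H_C2.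
apply: (@continuous_comp _ _ _ phase_pt ('D_(hdir j) H)); first exact: phase_pt_cont.
by apply/differentiable_continuous/D1d.
Qed.

Lemma velocityE t i : J t ->
  dx t i ord0 = \sum_j invmx (Omega a (x t)) i j * 'D_(hdir j) H (phase_pt t).
Proof.
move=> Jt; have [Ux _ E] := tr t Jt.
rewrite -[dx t](mulKmx (hOmega _ Ux)) E mxE; apply: eq_bigr => j _.
by rewrite mxE DscalE.
Qed.

(** Needed for the Lagrangian to have a primitive. *)
Lemma velocity_cont t i : J t -> {for t, continuous (fun s => dx s i ord0)}.
Proof.
move=> Jt; have : \forall s \near t, J s by apply: open_nbhs_nbhs.
move=> nJ.
have E : \forall s \near t, \sum_j invmx (Omega a (x s)) i j * 'D_(hdir j) H (phase_pt s) = dx s i ord0.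
  by apply: filterS nJ => s Js; rewrite velocityE.
rewrite /prop_for /continuous_at velocityE//.
apply: cvg_trans; first exact: (near_eq_cvg E).
apply: (cvg_big (op := +%R)) => [|j _]; first exact: add_continuous.
apply: cvgM; last exact: dH_cont.
exact: (continuous_invmx R R p (fun s => Omega a (x s)) t
  (fun u v => Omega_cont t u v Jt) (near_Omega_unit t Jt)).
Qed.

Definition lagrangian (t : R) := \sum_i a (x t) i ord0 * dx t i ord0 - H (phase_pt t).

Lemma lagrangian_cont t : J t -> {for t, continuous lagrangian}.
Proof.
move=> Jt; have [Ux _ _] := tr t Jt; have [dH _ _ _ _] := H_C2.
apply: cvgB; last first.
  apply: (@continuous_comp _ _ _ phase_pt H); first exact: phase_pt_cont.
  exact/differentiable_continuous/dH.
apply: (cvg_big (op := +%R)) => [|j _]; first exact: add_continuous.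
apply: cvgM; last exact: velocity_cont.
have [da _ _ _ _] := a_C2 j.
apply: (@continuous_comp _ _ _ x (fun z => a z j ord0)); first exact: traj_cont.
exact/differentiable_continuous/da.
Qed.

Lemma tube_constants (T : R) : (forall t : R, 0 <= t <= T -> J t) ->
  exists C : R, 0 < C /\ forall t : R, 0 <= t <= T ->
    [/\ forall w : 'cV[R]_p, `|w| < C^-1 ->
        [/\ forall i, `|a (x t + w) i ord0 - a (x t) i ord0| <= C * `|w|,
          forall i j, `|'D_(zdir j) a (x t + w) i ord0 - 'D_(zdir j) a (x t) i ord0|
             <= C * `|w| &
          forall i, `|a (x t + w) i ord0 - a (x t) i ord0
              - \sum_j w j ord0 * 'D_(zdir j) a (x t) i ord0| <= C * `|w| ^+ 2],
       forall w : 'cV[R]_p, `|w| < C^-1 ->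
          (forall j, `|'D_(hdir j) H (phase_pt t + (w, 0)) - 'D_(hdir j) H (phase_pt t)| <= C * `|w|)
          /\ `|H (phase_pt t + (w, 0)) - H (phase_pt t) - \sum_j w j ord0 * 'D_(hdir j) H (phase_pt t)|
             <= C * `|w| ^+ 2,
       forall i j, `|invmx (Omega a (x t)) i j| <= C &
       `|dx t| <= C].
Proof.
move=> hJ.
have n1 : \forall C \near +oo, forall i, forall t : R, 0 <= t <= T ->
    forall w : 'cV[R]_p, `|w| < C^-1 ->
    [/\ U (x t + lincomb R _ p zdir w),
     `|a (x t + lincomb R _ p zdir w) i ord0 - a (x t) i ord0| <= C * `|w|,
     forall j, `|'D_(zdir j) a (x t + lincomb R _ p zdir w) i ord0
        - 'D_(zdir j) a (x t) i ord0| <= C * `|w| &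
     `|a (x t + lincomb R _ p zdir w) i ord0 - a (x t) i ord0
       - \sum_j w j ord0 * 'D_(zdir j) a (x t) i ord0| <= C * `|w| ^+ 2].
  apply: filter_forall => i.
  apply: (tube_taylor _ _ _ _ _ _ _ zdir T x oU (a_C2 i)) => t /hJ Jt.
  by split; [case: (tr t Jt)|exact: traj_cont].
have n2 := tube_taylor _ _ _ _ _ _ _ hdir T phase_pt open_phase_space H_C2.
have {}n2 := n2 (fun t tT => conj (conj (let: And3 u _ _ := tr t (hJ t tT) in u) Logic.I)
   (phase_pt_cont t (hJ t tT))).
have n3 : \forall C \near +oo, forall i j, forall t : R, 0 <= t <= T ->
    `|invmx (Omega a (x t)) i j| <= C.
  apply: filter_forall => i; apply: filter_forall => j.
  apply: bounded_on_segment => t /hJ Jt.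
  exact: (continuous_invmx R R p (fun s => Omega a (x s)) t
    (fun u v => Omega_cont t u v Jt) (near_Omega_unit t Jt)).
have n4 : \forall C \near +oo, forall i, forall t : R, 0 <= t <= T ->
    `|dx t i ord0| <= C.
  apply: filter_forall => i.
  apply: bounded_on_segment => t /hJ; exact: velocity_cont.
have n5 : \forall C \near +oo, (0 : R) < C by apply: nbhs_pinfty_gt; exact: num_real.
case: (filter_ex (filterI (filterI (filterI n1 n2) (filterI n3 n4)) n5)).
move=> C [[[h1 h2] [h3 h4]] C0]; exists C; split => // t tT; split.
- move=> w wC; split.
  + by move=> i; have [_ + _ _] := h1 i t tT w wC; rewrite lincomb_zdir.
  + by move=> i j; have [_ _ + _] := h1 i t tT w wC; rewrite lincomb_zdir; apply.
  + by move=> i; have [_ _ _] := h1 i t tT w wC; rewrite lincomb_zdir.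
- move=> w wC; have [_ _ + +] := h2 t tT w wC; rewrite lincomb_hdir => A B.
  by split.
- by move=> i j; exact: h3.
- apply: norm_le_coord => [|i j]; first exact: ltW.
  by rewrite (ord1 j); exact: h4.
Qed.

End one_trajectory.

(** The vector field is Lipschitz near the orbit.  Subtracting Hamilton's
equations for the two orbits bounds [dy - dx] by a multiple of [u] and a term
[|u| |dy - dx|], which is absorbed when [u] is small. *)
Lemma difference_bounds (J : set R) ph (x dx : R -> 'cV[R]_p) (T : R) :
  open J -> traj J ph x dx -> (forall t : R, 0 <= t <= T -> J t) ->
  exists rho L C : R, [/\ 0 < rho, 0 <= L, 0 < C &
    forall (J' : set R) (y dy : R -> 'cV[R]_p), traj J' ph y dy ->
    forall t : R, 0 <= t <= T -> J' t -> `|y t - x t| < rho ->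
    let u := y t - x t in
    [/\ `|dy t - dx t| <= L * `|u|,
        forall i, `|a (y t) i ord0 - a (x t) i ord0| <= C * `|u|,
        forall i, `|a (y t) i ord0 - a (x t) i ord0
          - \sum_j u j ord0 * 'D_(zdir j) a (x t) i ord0| <= C * `|u| ^+ 2,
        `|H (phase_pt ph y t) - H (phase_pt ph x t) - \sum_j u j ord0 * 'D_(hdir j) H (phase_pt ph x t)|
          <= C * `|u| ^+ 2 &
        `|dx t| <= C]].
Proof.
move=> oJ tr hJ; have [C [C0 hC]] := tube_constants J ph x dx oJ tr T hJ.
pose N := p%:R * C; have N0 : 0 <= N by rewrite mulr_ge0// ltW.
(* The radius keeps [y] in the tube and makes the coefficient [2 N^2 |u|] of
   [|dy - dx|] at most [1 / 2]. *)
exists ((C + 4 * N ^+ 2)^-1), (2 * (N * C * (1 + 2 * N))), C; split => //.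
- by rewrite invr_gt0 ltr_wpDr// mulr_ge0// exprn_ge0.
- by rewrite !mulr_ge0// ?(ltW C0)// addr_ge0// mulr_ge0.
move=> J' y dy tr' t tT J't; set u := y t - x t => urho.
have [h1 h2 h3 h4] := hC t tT.
have CN0 : 0 < C + 4 * N ^+ 2 by rewrite ltr_wpDr// mulr_ge0// exprn_ge0.
have uC1 : `|u| * (C + 4 * N ^+ 2) < 1 by rewrite -ltr_pdivlMr// mul1r.
have uC : `|u| < C^-1.
  apply: lt_le_trans urho _; rewrite lef_pV2 ?posrE// lerDl mulr_ge0// exprn_ge0//.
have yE : y t = x t + u by rewrite addrC subrK.
have ptE : phase_pt ph y t = phase_pt ph x t + (u, 0).
  by rewrite /phase_pt yE; congr pair; rewrite addr0.
have [b1 b2 b3] := h1 u uC; have [b4 b5] := h2 u uC.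
split => //.
- set du := dy t - dx t.
  have [Ux _ Ex] := tr t (hJ t tT); have [Uy _ Ey] := tr' t J't.
  have Odu := linear_systems_difference _ _ _ _ _ _ _ _ Ex Ey.
  rewrite -/du in Odu; set g := (X in X - _) in Odu.
  have gb : `|g| <= C * `|u|.
    apply: norm_le_coord => [|i j]; first by rewrite mulr_ge0// ltW.
    rewrite (ord1 j) entryB DscalTE// DscalTE//.
    by have := b4 i; rewrite -ptE.
  have Ob i j : `|(Omega a (y t) - Omega a (x t)) i j| <= 2 * C * `|u|.
    have := dist_differences _ _ _ _ _ _ (b2 j i) (b2 i j).
    by rewrite -yE -!OmegaE -entryB mulrA.
  have dyb : `|dy t| <= C + `|du|.
    have -> : dy t = dx t + du by rewrite addrC subrK.
    by apply: (le_trans (ler_normD _ _)); rewrite lerD2r.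
  have Vb : `|Omega a (x t) *m du| <= C * `|u| + p%:R * (2 * C * `|u|) * (C + `|du|).
    rewrite Odu; apply: (le_trans (ler_normB _ _)); apply: lerD => //.
    apply: norm_mulmx => //; first by rewrite !mulr_ge0// ltW.
    by rewrite addr_ge0// ltW.
  have : `|du| <= p%:R * C * (C * `|u| + p%:R * (2 * C * `|u|) * (C + `|du|)).
    rewrite -{1}[du](mulKmx (hOmega _ Ux)); apply: norm_mulmx => //.
      exact: ltW.
    by apply: le_trans Vb.
  rewrite -/N (_ : p%:R * (2 * C * `|u|) = 2 * N * `|u|); last by rewrite /N; ring.
  move: uC1 (normr_ge0 u) (normr_ge0 du); move: `|u| `|du| => s d sC s0 d0 hd.
  have k1 : 0 <= s * C by rewrite mulr_ge0// ltW.
  have k2 : s * (4 * N ^+ 2) <= 1 by move: sC; rewrite mulrDr; lra.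
  have k3 : s * (4 * N ^+ 2) * d <= d by rewrite ler_piMl.
  by lra.
- by move=> i; rewrite yE.
- by move=> i; rewrite yE.
- by rewrite ptE.
Qed.

Lemma is_derive_pairing (V : normedModType R) (x u : V -> 'cV[R]_p)
    (dx du : 'cV[R]_p) (t v : V) :
  U (x t) -> is_derive t v x dx -> is_derive t v u du ->
  is_derive t v (fun s => \sum_i a (x s) i ord0 * u s i ord0)
    (\sum_i (a (x t) i ord0 * du i ord0 +
       u t i ord0 * \sum_j dx j ord0 * 'D_(zdir j) a (x t) i ord0)).
Proof.
move=> Ux xd ud.
have -> : (fun s => \sum_i a (x s) i ord0 * u s i ord0) =
    \sum_i ((fun s => a (x s) i ord0) * (fun s => u s i ord0)).
  by apply/funext => s; rewrite fct_sumE.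
apply: is_derive_sum => i.
have [da D1 _ _ _] := a_C2 i.
have xd' := is_derive_chain R V _ (fun z => a z i ord0) x t v dx (da _ Ux) xd.
have := derive_lincomb R _ (fun z => a z i ord0) p zdir (fun j => dx j ord0) (x t) (da _ Ux).
rewrite -/(lincomb R _ p zdir dx) lincomb_zdir => E; rewrite E in xd'.
have {}E : \sum_j dx j ord0 * 'D_(zdir j) (fun z => a z i ord0) (x t) =
  \sum_j dx j ord0 * 'D_(zdir j) a (x t) i ord0.
  by apply: eq_bigr => j _; rewrite D1.
rewrite E in xd'.
have ui : is_derive t v (fun s => u s i ord0) (du i ord0).
  case: ud => dut Eut; split; first by move/derivable_mxP : dut => /(_ i ord0).
  by rewrite derive_entry// Eut.
have := is_deriveM xd' ui; exact.
Qed.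

(** The difference of the actions minus the boundary terms is the integral of
the second-order terms left by [first_variation]; these are [O(|u t| ^ 2)],
hence [O(|u 0| ^ 2)] by [vector_gronwall]. *)
Lemma action_estimate (J : set R) ph (x dx : R -> 'cV[R]_p) (T : R) : 0 < T ->
  open J -> traj J ph x dx -> (forall t : R, 0 <= t <= T -> J t) ->
  exists delta M : R, [/\ 0 < delta, 0 <= M &
    forall (J' : set R) (y dy : R -> 'cV[R]_p) (Sx Sy : R -> R), traj J' ph y dy ->
    (forall t : R, 0 <= t <= T -> J' t) ->
    (forall t : R, 0 <= t <= T -> is_derive t 1 Sx (lagrangian ph x dx t)) ->
    (forall t : R, 0 <= t <= T -> is_derive t 1 Sy (lagrangian ph y dy t)) ->
    `|y 0 - x 0| < delta ->
    `|(Sy T - Sy 0) - (Sx T - Sx 0) -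
      (\sum_i a (x T) i ord0 * (y T - x T) i ord0 -
       \sum_i a (x 0) i ord0 * (y 0 - x 0) i ord0)| <= M * `|y 0 - x 0| ^+ 2].
Proof.
move=> T0 oJ tr hJ.
have [rho [L [C [rho0 L0 C0 hd]]]] := difference_bounds J ph x dx T oJ tr hJ.
pose Q := p%:R * expR (2 * p%:R * L * T).
have Q0 : 0 <= Q by rewrite mulr_ge0// expR_ge0.
have Q1 : 0 < Q + 1 by rewrite ltr_wpDl.
(* [Q] is the Gronwall factor: [Q (rho / (Q + 1)) ^ 2 < rho ^ 2] keeps the
   orbits within distance [rho] up to time [T]. *)
exists (rho / (Q + 1)), ((p%:R * C * L + p%:R * C * C + C) * Q * T); split.
- by rewrite divr_gt0.
- by rewrite !mulr_ge0 ?(ltW T0)// !addr_ge0 ?mulr_ge0// ltW.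
move=> J' y dy Sx Sy tr' hJ' Sxd Syd; set u0 := `|y 0 - x 0| => hu0.
pose u t := y t - x t; pose du t := dy t - dx t.
have ud (t : R) : 0 <= t <= T -> is_derive t 1 u (du t).
  move=> tT; have [_ xd _] := tr t (hJ t tT); have [_ yd _] := tr' t (hJ' t tT).
  exact: is_deriveB.
have gr (t : R) : 0 <= t <= T -> `|u t| ^+ 2 <= Q * u0 ^+ 2 /\ `|u t| < rho.
  apply: (vector_gronwall R p u du T L rho L0 rho0 ud).
    by move=> t' tT urho; have [] := hd J' y dy tr' t' tT (hJ' t' tT) urho.
  rewrite -/u0 mulrAC -/Q.
  have u00 : 0 <= u0 by exact: normr_ge0.
  move: hu0; rewrite ltr_pdivlMr// => hu0.
  apply: (@le_lt_trans _ _ ((u0 * (Q + 1)) ^+ 2)).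
    rewrite exprMn mulrC ler_wpM2l ?exprn_ge0//.
    by rewrite sqrrD1; have := sqr_ge0 Q; rewrite mulr2n; lra.
  by rewrite ltr_pXn2r// nnegrE ?mulr_ge0// ltW.
pose W t := Sy t - Sx t - \sum_i a (x t) i ord0 * u t i ord0.
pose dW t := lagrangian ph y dy t - lagrangian ph x dx t -
  \sum_i (a (x t) i ord0 * du t i ord0 +
       u t i ord0 * \sum_j dx t j ord0 * 'D_(zdir j) a (x t) i ord0).
have Wd (t : R) : 0 <= t <= T -> is_derive t 1 W (dW t).
  move=> tT; have [Ux xd _] := tr t (hJ t tT).
  apply: is_deriveB; first by apply: is_deriveB; [exact: Syd|exact: Sxd].
  exact: (is_derive_pairing _ _ _ _ _ _ _ Ux xd (ud t tT)).
have [t [tT EW]] := mvt_from0 R W dW T (ltW T0) Wd.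
have -> : Sy T - Sy 0 - (Sx T - Sx 0) -
   (\sum_i a (x T) i ord0 * (y T - x T) i ord0 -
    \sum_i a (x 0) i ord0 * (y 0 - x 0) i ord0) = W T - W 0.
  by rewrite /W /u; ring.
rewrite EW normrM (gtr0_norm T0) mulrAC ler_wpM2r ?(ltW T0)// -(mulrA _ Q).
have [uQ urho] := gr t tT.
have [b1 b2 b3 b4 b5] := hd J' y dy tr' t tT (hJ' t tT) urho.
apply: (@le_trans _ _ ((p%:R * C * L + p%:R * C * C + C) * `|u t| ^+ 2)); last first.
  by rewrite ler_wpM2l// !addr_ge0 ?mulr_ge0// ltW.
have [Ux _ Ex] := tr t (hJ t tT).
have ham j : \sum_i ('D_(zdir j) a (x t) i ord0 - 'D_(zdir i) a (x t) j ord0) * dx t i ord0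
    = 'D_(hdir j) H (phase_pt ph x t).
  have := congr1 (fun M : 'cV[R]_p => M j ord0) Ex; rewrite DscalTE// mxE => <-.
  by apply: eq_bigr => i _; rewrite OmegaE.
have dWE : dW t =
   \sum_i (a (y t) i ord0 - a (x t) i ord0) * du t i ord0
   + \sum_i (a (y t) i ord0 - a (x t) i ord0
          - \sum_j u t j ord0 * 'D_(zdir j) a (x t) i ord0) * dx t i ord0
   - (H (phase_pt ph y t) - H (phase_pt ph x t) - \sum_j u t j ord0 * 'D_(hdir j) H (phase_pt ph x t)).
  exact: (first_variation R p (fun i => a (x t) i ord0) (fun i => a (y t) i ord0)
    (fun i => dx t i ord0) (fun i => dy t i ord0) (fun i => u t i ord0)
    (fun i => du t i ord0) (fun i j => 'D_(zdir j) a (x t) i ord0)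
    (fun j => 'D_(hdir j) H (phase_pt ph x t)) (H (phase_pt ph x t)) (H (phase_pt ph y t))
    (fun i => entryB _ _ _ _ _ i ord0) ham).
rewrite dWE.
have pC (F : 'I_p -> R) (c : R) : (forall i, `|F i| <= c) -> `|\sum_i F i| <= p%:R * c.
  move=> h; apply: (le_trans (ler_norm_sum _ _ _)).
  rewrite mulr_natl -[p in leRHS]card_ord -sumr_const.
  by apply: ler_sum => i _; exact: h.
rewrite 2!(mulrDl _ _ (`|u t| ^+ 2)).
apply: (le_trans (ler_normB _ _)); apply: lerD => //.
apply: (le_trans (ler_normD _ _)); apply: lerD.
- rewrite -!mulrA; apply: pC => i; rewrite normrM.
  rewrite (_ : C * (L * `|u t| ^+ 2) = C * `|u t| * (L * `|u t|)); last by ring.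
  by apply: ler_pM => //; apply: le_trans b1; exact: norm_coord.
- rewrite -!mulrA; apply: pC => i; rewrite normrM.
  rewrite (_ : C * (C * `|u t| ^+ 2) = C * `|u t| ^+ 2 * C); last by ring.
  by apply: ler_pM => //; apply: le_trans b5; exact: norm_coord.
Qed.

End trajectories.

(** * Periodic functions *)

Section periodic_functions.
Variable R : realType.

Lemma derive_periodic (V W : normedModType R) (f : V -> W) (q x v : V) :
  (forall y, f (y + q) = f y) -> 'D_v f (x + q) = 'D_v f x.
Proof.
move=> per; rewrite /derive.
have -> : (fun h : R => h^-1 *: ((f \o shift (x + q)) (h *: v) - f (x + q))) =
          (fun h : R => h^-1 *: ((f \o shift x) (h *: v) - f x)) => //.
by apply/funext => h /=; rewrite addrA !per.
Qed.

Lemma heine (V : normedModType R) (A : set V) (Q : V -> R) (eps : R) : 0 < eps ->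
  compact A -> (forall x, {for x, continuous Q}) ->
  exists d : R, 0 < d /\ forall x y, A x -> `|y - x| < d -> `|Q x - Q y| < eps.
Proof.
move=> e0 /compact_near_coveringP cA cQ.
have e2 : 0 < eps / 2 by rewrite divr_gt0.
have : \forall C \near +oo, A `<=` [set x | forall y, `|y - x| < C^-1 -> `|Q x - Q y| < eps].
  apply: (cA R (pinfty_nbhs R) (fun C x => forall y, `|y - x| < C^-1 -> `|Q x - Q y| < eps)).
  move=> x0 _.
  have [r [r0 hr]] : exists r : R, 0 < r /\ forall y, `|y - x0| < r -> `|Q x0 - Q y| < eps / 2.
    by apply: near_ball; have /cvgrPdist_lt/(_ _ e2) := cQ x0.
  exists (ball x0 (r / 2), [set C | (r / 2)^-1 <= C]) => /=.
    split; first by apply: nbhsx_ballx; rewrite divr_gt0.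
    by apply: nbhs_pinfty_ge; exact: num_real.
  move=> [x C] /= [bx hC] y yx.
  have r20 : 0 < r / 2 by rewrite divr_gt0.
  have xx0 : `|x - x0| < r / 2 by move: bx; rewrite -ball_normE /ball_/= distrC.
  have yx' : `|y - x| < r / 2.
    apply: lt_le_trans yx _; rewrite -[leRHS]invrK lef_pV2 ?posrE ?invr_gt0//.
    by apply: lt_le_trans hC; rewrite invr_gt0.
  have h1 : `|Q x0 - Q x| < eps / 2 by apply: hr; lra.
  have h2 : `|Q x0 - Q y| < eps / 2.
    apply: hr; have := ler_distD x y x0; lra.
  have := ler_distD (Q x0) (Q x) (Q y); rewrite [`|Q x - Q x0|]distrC; lra.
have n5 : \forall C \near +oo, (0 : R) < C by apply: nbhs_pinfty_gt; exact: num_real.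
move=> nn; case: (filter_ex (filterI nn n5)) => C [hC C0].
by exists C^-1; split; [rewrite invr_gt0|move=> x y Ax; exact: hC].
Qed.

(** Average [g] over [N] equidistant translates along the period [v].  Its
[u]-derivative is the average of [c + Q], in which the average of [Q] is a
Riemann sum of the [v]-derivative of the periodic function [f] and tends to
[0] uniformly.  As the average of [g] is [u]-periodic, its [u]-derivative
vanishes somewhere, whence [c = 0]. *)
Lemma constant_curl_zero (V : normedModType R) (f g P Q : V -> R) (u v : V) (c : R) :
  (forall x, is_derive x u g (P x)) -> (forall x, is_derive x v f (Q x)) ->
  (forall x, {for x, continuous Q}) ->
  (forall x, f (x + v) = f x) -> (forall x, g (x + u) = g x) ->
  (forall x, P x - Q x = c) -> c = 0.
Proof.
move=> gP fQ cQ fper gper PQ.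
apply/eqP; rewrite -normr_le0; apply/ler_addgt0Pl => eps e0; rewrite addr0.
pose A := (fun z : R * R => z.1 *: u + z.2 *: v) @` (`[0, 1] `*` `[0, 1]).
have cA : compact A.
  apply: continuous_compact; last by apply: compact_setX; exact: segment_compact.
  apply: continuous_subspaceT => z.
  by apply: cvgD; apply: cvgZr_tmp; [exact: cvg_fst|exact: cvg_snd].
have [d [d0 hd]] := heine V A Q eps e0 cA cQ.
pose N := (Num.truncn (`|v| / d)).+1.
have N0 : 0 < N%:R :> R by rewrite ltr0n.
have vN : `|N%:R^-1 *: v| < d.
  rewrite normrZ gtr0_norm ?invr_gt0// mulrC ltr_pdivrMr// mulrC -ltr_pdivrMr//.
  exact: truncnS_gt.
pose pnt (t : R) (k : nat) : V := t *: u + (k%:R / N%:R) *: v.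
pose F t := \sum_(k < N) g (pnt t k).
have Fd (t : R) : 0 <= t <= 1 -> is_derive t 1 F (\sum_(k < N) P (pnt t k)).
  move=> _; have -> : F = \sum_(k < N) (fun t => g (pnt t k)).
    by apply/funext => s; rewrite fct_sumE.
  apply: is_derive_sum => k.
  have E : (fun t => g (pnt t k)) = (fun t => g ((k%:R / N%:R) *: v + t *: u)).
    by apply/funext => s; rewrite /pnt addrC.
  rewrite E; apply: is_derive_line; rewrite addrC; exact: gP.
have [t [t01]] := mvt_from0 R F _ 1 ler01 Fd.
rewrite mulr1 => EF.
have F10 : F 1 - F 0 = 0.
  apply/eqP; rewrite subr_eq0; apply/eqP; apply: eq_bigr => k _.
  by rewrite /pnt scale1r scale0r add0r addrC gper.
have mv k : exists s : R, 0 <= s <= 1 /\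
    f (pnt t k.+1) - f (pnt t k) = N%:R^-1 * Q (pnt t k + s *: (N%:R^-1 *: v)).
  have sc x : is_derive x (N%:R^-1 *: v) f (N%:R^-1 * Q x).
    have [fd <-] := fQ x; exact: is_derive_scale.
  have [|s [s01 Es]] := mvt_line R V f (pnt t k) (N%:R^-1 *: v).
    by move=> s _; case: (sc (pnt t k + s *: (N%:R^-1 *: v))).
  exists s; split => //; rewrite (@derive_val _ _ _ _ _ _ _ (sc _)) in Es.
  rewrite -Es; congr (f _ - _).
  by rewrite /pnt -natr1 mulrDl mul1r scalerDl addrA.
have [s hs] := choice mv.
(* With the mean value points as tags, the Riemann sum of the derivative of a
   periodic function is exactly [0]. *)
have Q0 : \sum_(k < N) Q (pnt t k + s k *: (N%:R^-1 *: v)) = 0.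
  have : \sum_(k < N) (f (pnt t k.+1) - f (pnt t k)) = 0.
    rewrite -(big_mkord xpredT (fun k => f (pnt t k.+1) - f (pnt t k))) telescope_sumr//.
    rewrite /pnt divff ?gt_eqF// scale1r fper mul0r scale0r addr0.
    by rewrite subrr.
  under eq_bigr do rewrite (hs _).2.
  by rewrite -mulr_sumr => /eqP; rewrite mulf_eq0 invr_eq0 gt_eqF//= => /eqP.
have Nc : N%:R * c = \sum_(k < N) (Q (pnt t k + s k *: (N%:R^-1 *: v)) - Q (pnt t k)).
  rewrite sumrB Q0 sub0r.
  have : \sum_(k < N) P (pnt t k) = 0 by rewrite -EF F10.
  have -> : \sum_(k < N) P (pnt t k) = \sum_(k < N) (c + Q (pnt t k)).
    by apply: eq_bigr => k _; rewrite -(PQ (pnt t k)) subrK.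
  rewrite big_split /= sumr_const card_ord => h.
  by apply/eqP; rewrite -addr_eq0 mulr_natl h.
have : N%:R * `|c| <= N%:R * eps.
  rewrite -[X in X * `|c|]ger0_norm// -normrM Nc.
  apply: (le_trans (ler_norm_sum _ _ _)).
  rewrite -[N in leRHS]card_ord mulr_natl -sumr_const; apply: ler_sum => k _.
  rewrite distrC; apply/ltW/hd.
    exists (t, k%:R / N%:R) => //; split; rewrite /= in_itv/=.
      exact: t01.
    by rewrite divr_ge0//= ler_pdivrMr// mul1r ler_nat ltnW.
  rewrite addrC addKr normrZ.
  have [/andP[s0 s1] _] := hs k.
  by apply: le_lt_trans vN; rewrite (ger0_norm s0) ler_piMl.
by rewrite ler_pM2l.
Qed.

End periodic_functions.

(** * Functions invariant under an irrational rotation *)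

Section minimal_rotation.
Variable R : realType.

Lemma minimal_constant m l (omega : 'cV[R]_m) (alpha : 'cV[R]_l)
    (G : 'cV[R]_m * 'cV[R]_l -> R) :
  rationally_independent omega alpha ->
  (forall x, {for x, continuous G}) ->
  (forall x, G (x + (omega, alpha)) = G x) ->
  (forall x k j, G (x + (intvec R k, intvec R j)) = G x) ->
  forall x y, G x = G y.
Proof.
move=> ind cG inv per x y.
apply/eqP; rewrite -subr_eq0 -normr_le0; apply/ler_addgt0Pl => eps e0; rewrite addr0.
have [r [r0 hr]] : exists r : R, 0 < r /\ forall z, `|z - y| < r -> `|G y - G z| < eps.
  by apply: near_ball; have /cvgrPdist_lt/(_ eps e0) := cG y.
pose rho (i : 'I_m + 'I_l) := match i with
  inl i => omega i ord0 | inr i => alpha i ord0 end.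
pose tgt (i : 'I_m + 'I_l) := match i with
  inl i => (y - x).1 i ord0 | inr i => (y - x).2 i ord0 end.
have indep (k : 'I_m + 'I_l -> int) (q : int) :
    \sum_i (k i)%:~R * rho i = q%:~R -> forall i, k i = 0.
  rewrite big_sumType /= => hk.
  pose k1 : 'cV[int]_m := \col_i k (inl i).
  pose k2 : 'cV[int]_l := \col_i k (inr i).
  have : (k1, k2) = (0, 0).
    apply: contrapT => /(ind k1 k2 q); apply.
    under eq_bigr do rewrite mxE.
    under [X in _ + X - _]eq_bigr do rewrite mxE.
    by rewrite hk subrr.
  move=> [/colP h1 /colP h2] [i|i].
    by have := h1 i; rewrite !mxE.
  by have := h2 i; rewrite !mxE.
have r20 : 0 < r / 2 by rewrite divr_gt0.
have [n [q hq]] := kronecker R _ rho tgt indep (r / 2) r20.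
pose z := x + (omega, alpha) *+ n +
   (intvec R (- \col_i q (inl i)), intvec R (- \col_i q (inr i))).
have Gz : G z = G x.
  rewrite /z per; elim: n {hq z} => [|n ih]; first by rewrite addr0.
  by rewrite mulrSr addrA inv.
rewrite -Gz distrC ltW//; apply: hr.
have mulE k : (omega, alpha) *+ k = (omega *+ k, alpha *+ k).
  by elim: k => // k ih; rewrite !mulrSr ih.
have zy : z - y = (omega *+ n - (y - x).1 - intvec R (\col_i q (inl i)),
                   alpha *+ n - (y - x).2 - intvec R (\col_i q (inr i))).
  rewrite /z mulE; congr pair; apply/colP => i; rewrite !mxE intrN; ring.
rewrite zy prod_normE /= gt_max; apply/andP; split.
  apply: (@le_lt_trans _ _ (r / 2)); last by lra.
  apply: norm_le_coord => [|i j]; first exact: ltW.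
  rewrite (ord1 j) ltW//.
  by have := hq (inl i); rewrite /= !mxE mulmxnE mulr_natl.
apply: (@le_lt_trans _ _ (r / 2)); last by lra.
apply: norm_le_coord => [|i j]; first exact: ltW.
rewrite (ord1 j) ltW//.
by have := hq (inr i); rewrite /= !mxE mulmxnE mulr_natl.
Qed.

End minimal_rotation.

(** * Invariant tori are isotropic *)

Lemma exchange_difference (W : zmodType) (c1 c2 c3 c4 : W) :
  c4 - c2 = c3 - c1 -> c3 - c4 = c1 - c2.
Proof.
by move=> h; apply/eqP; rewrite subr_eq addrAC -addrA h addrC subrK.
Qed.

Lemma curl_pairing (R : realType) p (a u v : 'I_p -> R) (Da : 'I_p -> 'I_p -> R)
    (uv vu : 'I_p -> R) (Om : 'I_p -> 'I_p -> R) :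
  (forall q, uv q = vu q) -> (forall k q, Om k q = Da q k - Da k q) ->
  \sum_q (a q * uv q + v q * \sum_k u k * Da q k) -
  \sum_q (a q * vu q + u q * \sum_k v k * Da q k) =
  \sum_k \sum_q u k * Om k q * v q.
Proof.
move=> sym OmE; under [X in X - _]eq_bigr do rewrite sym.
rewrite -sumrB.
under eq_bigr do rewrite opprD addrACA subrr add0r !mulr_sumr.
rewrite sumrB exchange_big -sumrB; apply: eq_bigr => k _.
by rewrite -sumrB; apply: eq_bigr => q _; rewrite OmE; ring.
Qed.

Section isotropy.
Variables (R : realType) (p m l : nat).
Variables (U : set 'cV[R]_p) (oU : open U).
Variables (a : 'cV[R]_p -> 'cV[R]_p) (ha : class_C 2 U a).
Hypothesis hOmega : forall z, U z -> Omega a z \in unitmx.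
Variable H : 'cV[R]_p * 'cV[R]_l -> R.
Hypothesis hH : class_C 2 (U `*` [set: 'cV[R]_l])
  (H : 'cV[R]_p * 'cV[R]_l -> R^o).
Variable alphahat : 'cV[R]_l.
Variables (I : 'cV[R]_p -> 'cV[R]_l -> set R)
  (E : R -> 'cV[R]_p -> 'cV[R]_l -> 'cV[R]_p).
Hypothesis hE : is_evolution_operator U (hamiltonian_field a H) alphahat I E.
Variables (T : R) (T0 : 0 < T) (omega : 'cV[R]_m).
Local Notation V := ('cV[R]_m * 'cV[R]_l)%type.
Variable K : V -> 'cV[R]_p.
Hypothesis hKper : forall x k j, K (x + (intvec R k, intvec R j)) = K x.
Hypothesis hK : class_C 2 [set: V] K.
Hypothesis hKU : forall x, U (K x).
Hypothesis hdef : forall x, I (K x) x.2 T.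
Let rho : V := (omega, T *: alphahat).
Hypothesis hinv : forall x, E T (K x) x.2 = K (x + rho).
Hypothesis hind : rationally_independent omega (T *: alphahat).

Let e (j : 'I_m) : V := (delta_mx j ord0, 0).
Let orbit (x : V) (t : R) := E t (K x) x.2.
Let velocity (x : V) (t : R) := hamiltonian_field a H (orbit x t) (x.2 + t *: alphahat).
Let J (x : V) := I (K x) x.2.

Let flow_interval x : [/\ open (J x), is_interval (J x), J x 0 & forall t : R, 0 <= t <= T -> J x t].
Proof.
have [[oJ iJ J0 _ _] _] := hE (K x) x.2 (hKU x).
split => // t t0T; apply: (iJ 0 T) => //; exact: hdef.
Qed.

Let orbit_traj x : traj R p l U a H alphahat (J x) x.2 (orbit x) (velocity x).
Proof.
have [[_ _ _ _ sol] _] := hE (K x) x.2 (hKU x).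
move=> t Jt; have [Ut dt] := sol t Jt; split => //.
by rewrite /velocity /hamiltonian_field mulKVmx// hOmega.
Qed.

Let orbit0 x : orbit x 0 = K x.
Proof. by have [[_ _ _ z0 _] _] := hE (K x) x.2 (hKU x). Qed.

Let orbitT x : orbit x T = K (x + rho).
Proof. exact: hinv. Qed.

(** The components of the primitive one-form pulled back to the fibres. *)
Definition pullback_form j x := \sum_i a (K x) i ord0 * 'D_(e j) K x i ord0.

Definition pullback_form_deriv v j x :=
  \sum_i (a (K x) i ord0 * 'D_v ('D_(e j) K) x i ord0 +
    'D_(e j) K x i ord0 * \sum_k 'D_v K x k ord0 * 'D_(zdir R p k) a (K x) i ord0).

Let K_diff x : differentiable K x.
Proof. by have [d _] := hK; exact: d. Qed.

Let DK_diff v x : differentiable ('D_v K) x.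
Proof. by have [_ d] := hK; have [dd _] := d v; exact: dd. Qed.

Let DDK_cont v w x : {for x, continuous ('D_w ('D_v K))}.
Proof. by have [_ d] := hK; have [_ dd] := d v; exact: dd. Qed.

Lemma is_derive_pullback_form v j x : is_derive x v (pullback_form j) (pullback_form_deriv v j x).
Proof.
apply: (is_derive_pairing R p U oU a ha V K ('D_(e j) K) _ _ x v) => //.
  by apply: derivableP; apply: diff_derivable; exact: K_diff.
by apply: derivableP; apply: diff_derivable; exact: DK_diff.
Qed.

Lemma pullback_form_deriv_cont v j x : {for x, continuous (pullback_form_deriv v j)}.
Proof.
have cK : {for x, continuous K} by exact: differentiable_continuous.
have cDK w i : {for x, continuous (fun y => 'D_w K y i ord0)}.
  by apply: continuous_entry; exact: differentiable_continuous.
have cDDK w w' i : {for x, continuous (fun y => 'D_w ('D_w' K) y i ord0)}.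
  by apply: continuous_entry; exact: DDK_cont.
apply: (cvg_big (op := +%R)) => [|i _]; first exact: add_continuous.
have [ad _ D1d _ _] := C2_coord R _ U p a i oU ha.
apply: cvgD; apply: cvgM.
- apply: (@continuous_comp _ _ _ K (fun z => a z i ord0)) => //.
  by apply: differentiable_continuous; exact: ad.
- exact: (cDDK v (e j) i).
- exact: cDK.
- apply: (cvg_big (op := +%R)) => [|k _]; first exact: add_continuous.
  apply: cvgM; first exact: cDK.
  apply: (@continuous_comp _ _ _ K (fun z => 'D_(zdir R p k) a z i ord0)) => //.
  by apply: differentiable_continuous; exact: D1d.
Qed.

Let action_ex x : exists S : R -> R, forall t : R, 0 <= t <= T ->
   is_derive t 1 S (lagrangian R p l a H alphahat x.2 (orbit x) (velocity x) t).
Proof.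
have [oJ iJ J0 JT] := flow_interval x.
have TT : J x T by apply: JT; rewrite ltW// lexx.
apply: (antiderivative R _ T (J x)) => // t Jt.
exact: (lagrangian_cont R p l U oU a ha hOmega H hH alphahat (J x) x.2 _ _ oJ (orbit_traj x)).
Qed.

(** The function is the action over the time interval [[0, T]] of the orbit
through the point of the torus.  By [action_estimate] it differs from the two
boundary terms, which are derivable, by a quantity of second order. *)
Lemma generating_function : exists s : V -> R, forall x j,
  is_derive x (e j) s (pullback_form j (x + rho) - pullback_form j x).
Proof.
have [S hS] := choice action_ex.
exists (fun x => S x T - S x 0) => x j.
have [oJ iJ J0 JT] := flow_interval x.
have [d [M [d0 M0 hest]]] := action_estimate R p l U oU a ha hOmega H hH alphahat
  (J x) x.2 (orbit x) (velocity x) T T0 oJ (orbit_traj x) JT.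
pose A y := \sum_i a (K (x + rho)) i ord0 * K (y + rho) i ord0.
pose B y := \sum_i a (K x) i ord0 * K y i ord0.
pose D y := S y T - S y 0 - (A y - B y).
have Kd y : is_derive y (e j) K ('D_(e j) K y).
  by apply: derivableP; apply: diff_derivable; exact: K_diff.
have lin c (F : V -> 'cV[R]_p) (dF : 'cV[R]_p) : is_derive x (e j) F dF ->
    is_derive x (e j) (fun y => \sum_i c i * F y i ord0) (\sum_i c i * dF i ord0).
  move=> [Fd <-].
  have -> : (fun y => \sum_i c i * F y i ord0) = \sum_i (c i \*: (fun y => F y i ord0)).
    by apply/funext => y; rewrite fct_sumE.
  apply: is_derive_sum => i; apply: is_deriveZ.
  split; first by move/derivable_mxP : Fd => /(_ i ord0).
  by rewrite derive_entry.
have Bd : is_derive x (e j) B (pullback_form j x) by apply: lin.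
have Ad : is_derive x (e j) A (pullback_form j (x + rho)).
  by apply: lin; apply: is_derive_translate; exact: Kd.
have Dd : is_derive x (e j) D 0.
  apply: (derive0_of_quadratic R V _ D K x (e j) M d) => //.
  move=> h hd.
  set y := h *: e j + x in hd *.
  have y2 : y.2 = x.2 by rewrite /y /= scaler0 add0r.
  have [_ _ _ JTy] := flow_interval y.
  have := hest (J y) (orbit y) (velocity y) (S x) (S y).
  rewrite -y2 => /(_ (orbit_traj y) JTy) .
  rewrite !orbit0 !orbitT {1}y2 => /(_ (hS x) (hS y) hd).
  have pair c (w w' : 'cV[R]_p) : \sum_i c i * (w - w') i ord0 =
      \sum_i c i * w i ord0 - \sum_i c i * w' i ord0.
    by rewrite -sumrB; apply: eq_bigr => i _; rewrite entryB mulrBr.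
  rewrite !pair -/(A y) -/(A x) -/(B y) -/(B x).
  by congr (`| _ | <= _); rewrite /D; ring.
have -> : (fun y => S y T - S y 0) = (fun y => D y + (A y - B y)).
  by apply/funext => y; rewrite /D subrK.
rewrite -[X in is_derive _ _ _ X]add0r.
by apply: is_deriveD => //; exact: is_deriveB.
Qed.

Definition curl i j x := pullback_form_deriv (e i) j x - pullback_form_deriv (e j) i x.

Lemma curl_invariant i j x : curl i j (x + rho) = curl i j x.
Proof.
have [s hs] := generating_function.
have Ds k : 'D_(e k) s = (fun y => pullback_form k (y + rho) - pullback_form k y).
  by apply/funext => y; have [_ ->] := hs y k.
have DDs v k y : is_derive y v ('D_(e k) s)
    (pullback_form_deriv v k (y + rho) - pullback_form_deriv v k y).
  rewrite Ds; apply: is_deriveB; last exact: is_derive_pullback_form.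
  by apply: is_derive_translate; exact: is_derive_pullback_form.
have DDsE v k : 'D_v ('D_(e k) s) =
    (fun y => pullback_form_deriv v k (y + rho) - pullback_form_deriv v k y).
  by apply/funext => y; have [_ ->] := DDs v k y.
have cDD v k y : {for y, continuous ('D_v ('D_(e k) s))}.
  rewrite DDsE; apply: cvgB; last exact: pullback_form_deriv_cont.
  apply: (@continuous_comp _ _ _ (fun z : V => z + rho) (pullback_form_deriv v k)).
    by apply: cvgD; [exact: cvg_id|exact: cvg_cst].
  exact: pullback_form_deriv_cont.
have sym := schwarz R _ s (e i) (e j) x
  (fun y => @ex_derive _ _ _ _ _ _ _ (hs y i)) (fun y => @ex_derive _ _ _ _ _ _ _ (hs y j))
  (fun y => @ex_derive _ _ _ _ _ _ _ (DDs (e j) i y))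
  (fun y => @ex_derive _ _ _ _ _ _ _ (DDs (e i) j y)) (cDD _ _ _) (cDD _ _ _).
have DDsP v k y : 'D_v ('D_(e k) s) y =
    pullback_form_deriv v k (y + rho) - pullback_form_deriv v k y by have [_ ->] := DDs v k y.
exact: exchange_difference (etrans (esym (DDsP (e j) i x)) (etrans sym (DDsP (e i) j x))).
Qed.

Let DK_per v k j x : 'D_v K (x + (intvec R k, intvec R j)) = 'D_v K x.
Proof. by apply: derive_periodic => y; exact: hKper. Qed.

Let DDK_per v w k j x :
  'D_w ('D_v K) (x + (intvec R k, intvec R j)) = 'D_w ('D_v K) x.
Proof. by apply: derive_periodic => y; exact: DK_per. Qed.

Lemma pullback_form_periodic i k j x :
  pullback_form i (x + (intvec R k, intvec R j)) = pullback_form i x.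
Proof. by rewrite /pullback_form hKper DK_per. Qed.

Lemma pullback_form_deriv_periodic v i k j x :
  pullback_form_deriv v i (x + (intvec R k, intvec R j)) = pullback_form_deriv v i x.
Proof.
rewrite /pullback_form_deriv hKper DK_per DDK_per; apply: eq_bigr => q _.
by congr (_ + _ * _); apply: eq_bigr => q' _; rewrite DK_per.
Qed.

Lemma curl_constant i j x y : curl i j x = curl i j y.
Proof.
have cc z : {for z, continuous (curl i j)}.
  exact: (cvgB (pullback_form_deriv_cont (e i) j z) (pullback_form_deriv_cont (e j) i z)).
have per z k k' : curl i j (z + (intvec R k, intvec R k')) = curl i j z.
  by rewrite /curl (pullback_form_deriv_periodic (e i)) (pullback_form_deriv_periodic (e j)).
exact: (minimal_constant R m l omega _ (curl i j) hind cc (curl_invariant i j) per x y).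
Qed.

Lemma e_intvec j : e j = (intvec R (delta_mx j ord0), intvec R 0).
Proof.
by rewrite /e /intvec map_delta_mx map_mx0.
Qed.

(** The fibre directions of the torus are periods, being images of integer
vectors. *)
Lemma curl_zero i j x : curl i j x = 0.
Proof.
apply: (constant_curl_zero R V (pullback_form i) (pullback_form j)
  (pullback_form_deriv (e i) j) (pullback_form_deriv (e j) i) (e i) (e j)).
- exact: is_derive_pullback_form.
- exact: is_derive_pullback_form.
- exact: pullback_form_deriv_cont.
- by move=> y; rewrite e_intvec pullback_form_periodic.
- by move=> y; rewrite e_intvec pullback_form_periodic.
- by move=> y; exact: curl_constant.
Qed.

Lemma curl_pullback_form i j x : curl i j x =
  \sum_k \sum_q 'D_(e i) K x k ord0 * Omega a (K x) k q * 'D_(e j) K x q ord0.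
Proof.
have sym q : 'D_(e i) ('D_(e j) K) x q ord0 = 'D_(e j) ('D_(e i) K) x q ord0.
  pose Kq y := K y q ord0.
  have DK v : 'D_v Kq = (fun y => 'D_v K y q ord0).
    by apply/funext => y; apply: derive_entry; apply: diff_derivable; exact: K_diff.
  have dK v y : derivable Kq y v.
    by apply: diff_derivable; apply: differentiable_entry; exact: K_diff.
  have DDK v w y : 'D_w ('D_v Kq) y = 'D_w ('D_v K) y q ord0.
    by rewrite DK; apply: derive_entry; apply: diff_derivable; exact: DK_diff.
  have dDK v w y : derivable ('D_v Kq) y w.
    rewrite DK; apply: diff_derivable; apply: differentiable_entry; exact: DK_diff.
  have cDD v w y : {for y, continuous ('D_w ('D_v Kq))}.
    have -> : 'D_w ('D_v Kq) = (fun y => 'D_w ('D_v K) y q ord0).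
      by apply/funext => z; exact: DDK.
    by apply: continuous_entry; exact: DDK_cont.
  have := schwarz R V Kq (e i) (e j) x (dK _) (dK _) (dDK _ _) (dDK _ _) (cDD _ _ _) (cDD _ _ _).
  by move=> h; exact: etrans (esym (DDK (e j) (e i) x)) (etrans (esym h) (DDK (e i) (e j) x)).
exact: (curl_pairing R p (fun q => a (K x) q ord0) (fun k => 'D_(e i) K x k ord0)
  (fun k => 'D_(e j) K x k ord0) (fun q k => 'D_(zdir R p k) a (K x) q ord0)
  (fun q => 'D_(e i) ('D_(e j) K) x q ord0) (fun q => 'D_(e j) ('D_(e i) K) x q ord0)
  (fun k q => Omega a (K x) k q) sym (OmegaE R p a (K x))).
Qed.

Lemma invariant_torus_isotropic x i j :
  \sum_k \sum_q 'D_(e i) K x k ord0 * Omega a (K x) k q * 'D_(e j) K x q ord0 = 0.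
Proof. by rewrite -curl_pullback_form curl_zero. Qed.

End isotropy.

Theorem lemmaB1 (R : realType) (n d l : nat) (hd : (0 < d)%N)
    (U : set 'cV[R]_(2 * n)) (hU : open U)
    (a : 'cV[R]_(2 * n) -> 'cV[R]_(2 * n))
    (ha : class_C 2 U a)
    (hOmega : forall z, U z -> Omega a z \in unitmx)
    (alphahat : 'cV[R]_l)
    (H : 'cV[R]_(2 * n) * 'cV[R]_l -> R)
    (hHper : forall z phi (j : 'cV[int]_l), U z ->
       H (z, phi + intvec R j) = H (z, phi))
    (hH : class_C 2 (U `*` [set: 'cV[R]_l])
       (H : 'cV[R]_(2 * n) * 'cV[R]_l -> R^o))
    (I : 'cV[R]_(2 * n) -> 'cV[R]_l -> set R)
    (E : R -> 'cV[R]_(2 * n) -> 'cV[R]_l -> 'cV[R]_(2 * n))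
    (hE : is_evolution_operator U (hamiltonian_field a H) alphahat I E)
    (T : R) (hT : 0 < T)
    (omega : 'cV[R]_d.-1) (alpha : 'cV[R]_l) (halpha : alpha = T *: alphahat)
    (K : 'cV[R]_d.-1 * 'cV[R]_l -> 'cV[R]_(2 * n))
    (hKper : forall theta phi (k : 'cV[int]_d.-1) (j : 'cV[int]_l),
       K (theta + intvec R k, phi + intvec R j) = K (theta, phi))
    (hK : class_C 2 [set: 'cV[R]_d.-1 * 'cV[R]_l] K)
    (hKU : forall theta phi, U (K (theta, phi)))
    (hdef : forall theta phi, I (K (theta, phi)) phi T)
    (hinv : forall theta phi,
       E T (K (theta, phi)) phi = K (theta + omega, phi + alpha))
    (hind : rationally_independent omega alpha) :
  (forall phi theta,
     (Jac (fun th => K (th, phi)) theta)^T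
       *m Omega a (K (theta, phi))
       *m Jac (fun th => K (th, phi)) theta = 0)
  /\ fiberwise_isotropic a K.
Proof.
have main phi theta : (Jac (fun th => K (th, phi)) theta)^T
       *m Omega a (K (theta, phi))
       *m Jac (fun th => K (th, phi)) theta = 0.
  have K_diff x : differentiable K x by have [dK _] := hK; exact: dK.
  have JE k j : Jac (fun th => K (th, phi)) theta k j =
      'D_((delta_mx j ord0, 0) : 'cV[R]_d.-1 * 'cV[R]_l) K (theta, phi) k ord0.
    rewrite mxE; set v : 'cV[R]_d.-1 * 'cV[R]_l := (delta_mx j ord0, 0).
    have dv : is_derive (theta, phi) v K ('D_v K (theta, phi)).
      by apply: derivableP; apply: diff_derivable; exact: K_diff.
    suff : is_derive theta (delta_mx j ord0) (fun th => K (th, phi)) ('D_v K (theta, phi)).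
      by case=> _ ->.
    apply: is_derive_transfer dv => h; congr (K (_, _)).
    by rewrite -[(h *: v).2]/(h *: (0 : 'cV[R]_l)) scaler0 add0r.
  subst alpha.
  have Kper x k j : K (x + (intvec R k, intvec R j)) = K x.
    by case: x => th ph; exact: hKper.
  have KU x : U (K x) by case: x => th ph; exact: hKU.
  have Kdef x : I (K x) x.2 T by case: x => th ph; exact: hdef.
  have Kinv x : E T (K x) x.2 = K (x + (omega, T *: alphahat)).
    by case: x => th ph; exact: hinv.
  apply/matrixP => i j; rewrite [RHS]mxE mxE.
  rewrite -[RHS](invariant_torus_isotropic R (2 * n) d.-1 l U hU a ha hOmega H hH
    alphahat I E hE T hT omega K Kper hK KU Kdef Kinv hind (theta, phi) i j).
  rewrite exchange_big /=; apply: eq_bigr => q _; rewrite mxE mulr_suml.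
  by apply: eq_bigr => k _; rewrite mxE !JE.
by split => // phi theta; exact: main.
Qed.
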